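(* There is a universal constant $C>0$ such that the following holds. Fix an approximation weight $\mathsf W$. Suppose that $(\mu,\rho,V,\mathcal L)$ is relatively admissible and satisfies the reference-weight concentration condition with respect to $\mathsf W$. Then, for every $\sigma>0$ and every $0<\xi<1$, there exist $J\ge1$ and an integer $M$ satisfying $$\frac{6QJ}{\sigma^2}\log\left(\frac{6N}{\xi}\right)\le M\le\frac{7QJ}{\sigma^2}\log\left(\frac{6N}{\xi}\right),$$ such that, with probability at least $1-\xi$ over independent samples $x_1,\dots,x_M\sim\rho$, the least squares quadrature rule is well-defined, exact on $V$, and satisfies $$\kappa_{\mathsf W}(\mathcal Q_M)\le(1+\sigma)\left[\left\|\frac{L}{\mathsf W}\right\|_{L^1_\mu(D)}+C\left\|\mathsf K_{\mathcal L,\rho,\mathsf W}(X)\right\|_{\psi_1}\frac{\log(6/\xi)}{\sqrt M}\right],\qquad X\sim\rho.$$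
   Context: Setting. $\mu$ is a positive measure with closed support $D$ in a Banach space; functions on $D$ are $\mu$-measurable, complex-valued and pointwise defined. $\langle u,v\rangle=\int_D\overline{u}\,v\,d\mu$ and $\|\cdot\|$ are the inner product and norm of $L^2_\mu(D)$. $V\subset L^2_\mu(D)$ is a subspace of finite complex dimension $N\geq 1$; an $L^2_\mu$-orthonormal basis of $V$ is fixed, with fixed measurable pointwise representatives $\varphi_1,\dots,\varphi_N$, and $V$ is identified with the space of pointwise-defined functions $\sum_n c_n\varphi_n$. Write $\boldsymbol\varphi(x)=(\varphi_1(x),\dots,\varphi_N(x))^T$ and $k(x)=\sum_{n=1}^N|\varphi_n(x)|^2$. Sampling measure. $\tau^2:D\to[0,\infty)$ is measurable with $\int_D\tau^2\,d\mu=1$ and satisfies the coverage condition: $k(x)=0$ for $\mu$-almost every $x\in\{\tau^2=0\}$. $\rho$ is the probability measure $d\rho=\tau^2\,d\mu$, and $Q=\operatorname{ess\,sup}_{x\sim\rho}k(x)/\tau^2(x)$. Ratios of nonnegative quantities use the conventions $0/0=0$ and $a/0=+\infty$ for $a>0$. Functional. $\mathcal L\in V^*$ is a nonzero linear functional, $\ell_n=\mathcal L(\varphi_n)$, $\boldsymbol\ell=(\ell_1,\dots,\ell_N)^T$, $L=\sum_n\overline{\ell_n}\varphi_n\in V$ is its Riesz representer ($\mathcal L(v)=\langle L,v\rangle$ for $v\in V$), and $\|\mathcal L\|_{V^*}=\|L\|=\|\boldsymbol\ell\|_2$. Least squares quadrature rule. For independent samples $x_1,\dots,x_M\sim\rho$,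 let $\mathbf G^{(M)}=\frac1M\sum_{m=1}^M\frac{\overline{\boldsymbol\varphi(x_m)}\,\boldsymbol\varphi(x_m)^T}{\tau^2(x_m)}$. The rule is well-defined if $\mathbf G^{(M)}$ is invertible; then its weights are $w_m=\frac{1}{M\tau^2(x_m)}\boldsymbol\ell^T(\mathbf G^{(M)})^{-1}\overline{\boldsymbol\varphi(x_m)}$ and $\mathcal Q_M(u)=\sum_{m=1}^Mw_mu(x_m)$. Exact on $V$ means $\mathcal Q_M(v)=\mathcal L(v)$ for all $v\in V$. Relative admissibility. Let $\cos\gamma(x)=\frac{|L(x)|}{\|\mathcal L\|_{V^*}\sqrt{k(x)}}$ if $k(x)>0$ and $\cos\gamma(x)=1$ if $k(x)=0$. Let $p_J=\Pr_{X\sim\rho}[1/\cos\gamma(X)\ge J^{1/2}]$. The tuple $(\mu,\rho,V,\mathcal L)$ is relatively admissible if $Q<\infty$ and $\lim_{J\to\infty}Jp_J=0$. Approximation weight and condition number. An approximation weight is a positive measurable $\mathsf W:D\to(0,\infty)$. $\mathcal B^\infty_{\mathsf W}(D)$ is the space of pointwise-defined $\mu$-measurable $u:D\to\mathbb C$ with $\|u\|_{\infty,\mathsf W}=\sup_{x\in D}\mathsf W(x)|u(x)|<\infty$, and $\kappa_{\mathsf W}(\mathcal Q_M)=\sup\{|\mathcal Q_M(u)|:u\in\mathcal B^\infty_{\mathsf W}(D),\ \|u\|_{\infty,\mathsf W}\le1\}$. Reference-weight concentration. $\mathsf K_{\mathcal L,\rho,\mathsf W}(x)=\frac{|L(x)|}{\tau^2(x)\mathsf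 W(x)}$, set to $0$ where $\tau^2(x)=0$. The reference-weight concentration condition is that, for $X\sim\rho$, $\|\mathsf K_{\mathcal L,\rho,\mathsf W}(X)\|_{\psi_1}=\inf\{c>0:\mathbb E_\rho[\exp(\mathsf K_{\mathcal L,\rho,\mathsf W}(X)/c)]\le2\}<\infty$. *)

(* Defs.v *)
From HB Require Import structures.
From mathcomp Require Import all_boot all_order all_algebra.
From mathcomp Require Import complex.
From mathcomp Require Import all_classical all_reals all_analysis ess_sup_inf.

Set Implicit Arguments.
Unset Strict Implicit.
Unset Printing Implicit Defensive.

Import Order.TTheory GRing.Theory Num.Theory.
Import numFieldNormedType.Exports.

Local Open Scope classical_set_scope.
Local Open Scope ring_scope.
Local Open Scope complex_scope.

(* A function on D is represented by a total function on the ambient space T;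
   measurability is relative to D, and every integral, supremum and event below
   only uses its values on D. *)

(* The norm of R[i] provided by its numeric structure is R[i]-valued. *)
Definition cabs (R : realType) (z : R[i]) : R := ComplexField.Normc.normc z.

Definition cmeasurable_fun d (T : measurableType d) (R : realType)
    (D : set T) (u : T -> R[i]) : Prop :=
  measurable_fun D (fun x => complex.Re (u x)) /\
  measurable_fun D (fun x => complex.Im (u x)).

Definition closed_support (X : topologicalType) (R : realType)
    (mu : set X -> \bar R) (D : set X) : Prop :=
  [/\ closed D, mu (~` D) = 0%E
    & forall F : set X, closed F -> mu (~` F) = 0%E -> D `<=` F].

(* a / b for nonnegative a and b, with 0 / 0 = 0 and a / 0 = +oo if a > 0. *)
Definition nnratio (R : realType) (a b : R) : \bar R :=
  if b == 0 then (if a == 0 then 0%E else +oo%E) else (a / b)%:E.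

Section L2.
Context d (T : measurableType d) (R : realType).
Context (mu : {measure set T -> \bar R}) (D : set T).

Definition cintegral (f : T -> R[i]) : R[i] :=
  Rintegral mu D (fun x => complex.Re (f x)) +i*
  Rintegral mu D (fun x => complex.Im (f x)).

Definition inner (u v : T -> R[i]) : R[i] :=
  cintegral (fun x => (u x)^* * v x).

Definition in_L2 (u : T -> R[i]) : Prop :=
  cmeasurable_fun D u /\ (\int[mu]_(x in D) ((cabs (u x)) ^+ 2)%:E < +oo)%E.

Definition L2norm (u : T -> R[i]) : R :=
  Num.sqrt (Rintegral mu D (fun x => cabs (u x) ^+ 2)).

Definition orthonormal_system (N : nat) (phi : 'I_N -> T -> R[i]) : Prop :=
  (forall n, in_L2 (phi n)) /\
  (forall i j, inner (phi i) (phi j) = (i == j)%:R).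

Definition lin_span (N : nat) (phi : 'I_N -> T -> R[i]) : set (T -> R[i]) :=
  [set v | exists c : 'I_N -> R[i], v = fun x => \sum_(n < N) c n * phi n x].

(* Only the values of Lf on V matter. *)
Definition linear_functional_on (V : set (T -> R[i]))
    (Lf : (T -> R[i]) -> R[i]) : Prop :=
  forall (a : R[i]) u v, V u -> V v ->
    Lf (fun x => a * u x + v x) = a * Lf u + Lf v.

Definition dual_norm (V : set (T -> R[i])) (Lf : (T -> R[i]) -> R[i]) : R :=
  sup [set cabs (Lf v) | v in [set v | V v /\ L2norm v <= 1]].

End L2.

Section Functional.
Context d (T : measurableType d) (R : realType) (N : nat).
Context (phi : 'I_N -> T -> R[i]).

Definition christoffel (x : T) : R := \sum_(n < N) cabs (phi n x) ^+ 2.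

Definition riesz_representer (Lf : (T -> R[i]) -> R[i]) (x : T) : R[i] :=
  \sum_(n < N) (Lf (phi n))^* * phi n x.

End Functional.

Section Sampling.
Context d (T : measurableType d) (R : realType).
Context (mu : {measure set T -> \bar R}) (D : set T).
Context (N : nat) (phi : 'I_N -> T -> R[i]).

Definition sampling_density (tau2 : T -> R) : Prop :=
  [/\ measurable_fun D tau2, (forall x, D x -> 0 <= tau2 x),
      (\int[mu]_(x in D) (tau2 x)%:E = 1)%E
    & {ae mu, forall x, D x -> tau2 x = 0 -> christoffel phi x = 0}].

Definition has_density (rho : set T -> \bar R) (tau2 : T -> R) : Prop :=
  forall A : set T, measurable A ->
    (rho A = \int[mu]_(x in A `&` D) (tau2 x)%:E)%E.

Definition Qsup (rho : probability T R) (tau2 : T -> R) : \bar R :=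
  ess_sup rho (fun x => nnratio (christoffel phi x) (tau2 x)).

Definition cos_gamma (Lf : (T -> R[i]) -> R[i]) (x : T) : R :=
  if 0 < christoffel phi x then
    cabs (riesz_representer phi Lf x) /
      (dual_norm mu D (lin_span phi) Lf * Num.sqrt (christoffel phi x))
  else 1.

Definition tail_prob (rho : probability T R) (Lf : (T -> R[i]) -> R[i])
    (J : R) : \bar R :=
  rho [set x | D x /\ ((Num.sqrt J)%:E <= nnratio 1 (cos_gamma Lf x))%E].

Definition relatively_admissible (rho : probability T R) (tau2 : T -> R)
    (Lf : (T -> R[i]) -> R[i]) : Prop :=
  (Qsup rho tau2 < +oo)%E /\
  (fun J : R => (J%:E * tail_prob rho Lf J)%E) @ +oo%R --> 0%E.

Definition approximation_weight (W : T -> R) : Prop :=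
  measurable_fun D W /\ (forall x, D x -> 0 < W x).

Definition Kfun (tau2 W : T -> R) (Lf : (T -> R[i]) -> R[i]) (x : T) : R :=
  if tau2 x == 0 then 0
  else cabs (riesz_representer phi Lf x) / (tau2 x * W x).

(* Used for a probability rho carried by D; the infimum of the empty set is
   +oo. *)
Definition psi1_norm (rho : probability T R) (f : T -> R) : \bar R :=
  ereal_inf [set c%:E | c in
    [set c : R | 0 < c /\
      (\int[rho]_(x in D) (expR (f x / c))%:E <= 2%:E)%E]].

Definition wsup_norm (W : T -> R) (u : T -> R[i]) : \bar R :=
  ereal_sup [set (W x * cabs (u x))%:E | x in D].

Definition Binfty (W : T -> R) : set (T -> R[i]) :=
  [set u | cmeasurable_fun D u /\ (wsup_norm W u < +oo)%E].

Definition cond_number (W : T -> R) (Qu : (T -> R[i]) -> R[i]) : \bar R :=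
  ereal_sup [set (cabs (Qu u))%:E | u in
    [set u | Binfty W u /\ (wsup_norm W u <= 1)%E]].

End Sampling.

Section Quadrature.
Context d (T : measurableType d) (R : realType) (N M : nat).
Context (phi : 'I_N -> T -> R[i]) (tau2 : T -> R).
Context (Lf : (T -> R[i]) -> R[i]) (pts : 'I_M -> T).

Definition gram : 'M[R[i]]_N :=
  \matrix_(i < N, j < N)
    (M%:R^-1 * \sum_(m < M)
       (phi i (pts m))^* * phi j (pts m) / (tau2 (pts m))%:C).

Definition ls_weight (m : 'I_M) : R[i] :=
  (M%:R * (tau2 (pts m))%:C)^-1 *
  ((\row_(n < N) Lf (phi n)) *m invmx gram
     *m (\col_(n < N) (phi n (pts m))^*)) ord0 ord0.

Definition ls_rule (u : T -> R[i]) : R[i] :=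
  \sum_(m < M) ls_weight m * u (pts m).

Definition well_defined_rule : Prop := gram \in unitmx.

Definition exact_on (V : set (T -> R[i])) : Prop :=
  forall v, V v -> ls_rule v = Lf v.

End Quadrature.

Section Independence.
Context d (T : measurableType d) (R : realType).
Context dO (Omega : measurableType dO) (P : probability Omega R) (M : nat).

Definition mutually_independent (x : 'I_M -> Omega -> T) : Prop :=
  forall (I : {set 'I_M}) (A : 'I_M -> set T), (forall m, measurable (A m)) ->
    (P (\bigcap_(m in [set m | m \in I]) (x m @^-1` A m)) =
     \prod_(m in I) P (x m @^-1` A m))%E.

Definition iid_samples (rho : probability T R)
    (x : 'I_M -> {mfun Omega >-> T}) : Prop :=
  mutually_independent (fun m => x m : Omega -> T) /\
  (forall m (A : set T), measurable A -> P (x m @^-1` A) = rho A).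

End Independence.

(* Main.v *)
Require Import Defs.
From HB Require Import structures.
From mathcomp Require Import all_boot all_order all_algebra.
From mathcomp Require Import complex ring lra.
From mathcomp Require Import all_classical all_reals all_analysis.
From mathcomp Require Import measurable_realfun ess_sup_inf.

Set Implicit Arguments.
Unset Strict Implicit.
Unset Printing Implicit Defensive.

Import Order.TTheory GRing.Theory Num.Theory.
Import numFieldNormedType.Exports.

Local Open Scope classical_set_scope.
Local Open Scope ring_scope.

(** The ideal weights are w0_m = conj (L (x_m)) / (M tau2 (x_m)). Their
    weighted absolute sum is an average of independent copies of K, with mean
    the integral of |L| / W, so Bernstein's inequality for subexponential
    variables ([subexponential_tail], [average_Kfun_tail]) produces the bracket
    of the theorem. The least squares weights replace the row l by
    r = l G^-1, and (r - l) conj phi is at most |r - l| sqrt k, which is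
    |r - l| / (|l| cos gamma) times |L|. As soon as 1 / cos gamma <= sqrt J at
    every sample and |r - l| <= sigma |l| / sqrt J, each weight is at most
    1 + sigma times the ideal one ([ls_weight_le], [cond_number_ls_rule_le]).

    Only one concentration estimate has to be sharp. From l = r G one gets
    r - l = (l - l G) - (r - l) (G - 1), so an error |l G - l| is amplified by
    1 / (1 - e) once the Frobenius norm of G - 1 is at most e
    ([inverse_perturbation]). The accuracy e = 1/10 is fixed while M tends to
    infinity with J, so the crude bound [gram_deviation] is enough for it; no
    matrix concentration inequality is involved. The accuracy of l G is of the
    order of sqrt (Q Lambda / M), with Lambda = ln (6 N / xi). Here l G - l has
    2 N real coordinates, whose variances add up to at most Q |l|^2 / M. Giving
    each coordinate a threshold proportional to its standard deviation, a
    scalar exponential tail and a union bound over the 4 N one-sided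
    deviations give a failure probability 4 N exp (- Lambda) = 2 xi / 3
    ([empirical_pairing_deviation]).

    Finally M p_J tends to 0 along M = 6 Q J Lambda / sigma^2 by relative
    admissibility, so for large M the angle condition fails with probability
    at most xi / 9. Choosing M first and J = M sigma^2 / (6 Q Lambda)
    afterwards makes the integrality of M harmless. *)

(** * Change of variables *)

Section change_of_variables.
Context d1 d2 (T1 : measurableType d1) (T2 : measurableType d2) (R : realType).
Context (m : {measure set T1 -> \bar R}) (nu : {measure set T2 -> \bar R}).
Context (h : T1 -> R) (X : T1 -> T2).
Hypotheses (mh : measurable_fun setT h) (h0 : forall x, 0 <= h x).
Hypothesis mX : measurable_fun setT X.
Hypothesis nuE : forall A, measurable A ->
  nu A = (\int[m]_(t in X @^-1` A) (h t)%:E)%E.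

Import HBNNSimple.

(** The hypothesis says that nu is the image by X of the measure of density h
    with respect to m. Taking X the identity, h a density of nu, this turns
    integrals against rho into integrals against mu, without sigma-finiteness;
    taking X one sample and h a function of the others, it is the inductive
    step in the proof that independence factors expectations. *)
Lemma ge0_change_of_variables (g : T2 -> \bar R) :
  measurable_fun setT g -> (forall y, (0 <= g y)%E) ->
  (\int[nu]_y g y = \int[m]_t (g (X t) * (h t)%:E))%E.
Proof.
move=> mg g0; pose g_ := nnsfun_approx measurableT mg.
have gE y : g y = lim ((EFin \o g_ n) y @[n --> \oo]).
  by apply/esym/cvg_lim => //; apply: cvg_nnsfun_approx.
have mgX n : measurable_fun setT (fun t => g_ n (X t)).
  exact: measurableT_comp.
have mgXh n : measurable_fun setT (fun t => ((g_ n (X t))%:E * (h t)%:E)%E).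
  by apply: emeasurable_funM; apply/measurable_EFinP.
have -> : (\int[nu]_y g y = lim (\int[nu]_y (EFin \o g_ n) y @[n --> \oo]))%E.
  under eq_integral do rewrite gE.
  apply: monotone_convergence => //.
  - by move=> n; apply/measurable_EFinP.
  - by move=> n x _ /=; rewrite lee_fin.
  - by move=> x _ a b ab; rewrite lee_fin; exact/lefP/nd_nnsfun_approx.
have -> : (\int[m]_t (g (X t) * (h t)%:E) =
    lim (\int[m]_t ((EFin \o g_ n) (X t) * (h t)%:E) @[n --> \oo]))%E.
  have E t : (g (X t) * (h t)%:E =
      lim (((EFin \o g_ n) (X t) * (h t)%:E) @[n --> \oo]))%E.
    apply/esym/cvg_lim => //; apply: cvgeZr => //.
    exact: cvg_nnsfun_approx.
  under eq_integral do rewrite E.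
  apply: monotone_convergence => //.
  - by move=> n x _ /=; rewrite mule_ge0 ?lee_fin.
  - move=> x _ a b ab /=; rewrite lee_wpmul2r ?lee_fin//.
    exact/lefP/nd_nnsfun_approx.
congr (lim (_ @ \oo)); apply/funext => n /=.
transitivity (\int[nu]_y (\sum_(r \in range (g_ n))
    (r * \1_(g_ n @^-1` [set r]) y)%:E))%E.
  by apply: eq_integral => t _; rewrite /= [in LHS]fimfunE -fsumEFin.
have mi r : measurable (g_ n @^-1` [set r]) by exact: measurable_funPTI.
have m1 r : measurable_fun setT (fun t => \1_(g_ n @^-1` [set r]) (X t) : R).
  by apply: (measurableT_comp _ mX); exact: measurable_indic.
rewrite ge0_integral_fsum//; last 2 first.
- by move=> r; apply/measurable_EFinP; apply: measurable_funM.
- by move=> r y _; exact: nnfun_muleindic_ge0.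
transitivity (\int[m]_t (\sum_(r \in range (g_ n))
    (r * \1_(g_ n @^-1` [set r]) (X t))%:E * (h t)%:E))%E; last first.
  apply: eq_integral => t _.
  rewrite -ge0_mule_fsuml => [|r]; last exact: nnfun_muleindic_ge0.
  by rewrite fsumEFin// -(fimfunE _ (X t)).
rewrite ge0_integral_fsum//; last 2 first.
- move=> r; apply: emeasurable_funM; apply/measurable_EFinP => //.
  exact: measurable_funM.
- by move=> r t _; rewrite mule_ge0 ?lee_fin//; exact: nnfun_muleindic_ge0.
apply: eq_fsbigr => r; rewrite inE => -[y _ <-{r}]; set r := g_ n y.
have r0 : 0 <= r by rewrite /r.
have mXi : measurable (X @^-1` (g_ n @^-1` [set r])).
  by rewrite -[X in measurable X]setTI; exact: mX.
under eq_integral do rewrite EFinM.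
rewrite ge0_integralZl//; last first.
  by apply/measurable_EFinP.
rewrite integral_indic// setIT nuE// integral_mkcond.
under [RHS]eq_integral do rewrite EFinM -muleA.
rewrite ge0_integralZl//; last 2 first.
- apply: emeasurable_funM; exact/measurable_EFinP.
- by move=> t _; rewrite mule_ge0 ?lee_fin.
congr (_ * _)%E; apply: eq_integral => t _.
rewrite patchE indicE; case: ifPn => tX.
  by rewrite (_ : X t \in _) ?mul1e// inE; move: tX; rewrite inE.
rewrite (_ : X t \in _ = false) ?mul0e//; apply/negbTE.
by apply: contra tX; rewrite !inE.
Qed.

Lemma change_of_variables (g : T2 -> \bar R) : measurable_fun setT g ->
  (\int[nu]_y g y = \int[m]_t (g (X t) * (h t)%:E))%E.
Proof.
move=> mg; rewrite integralE [RHS]integralE.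
rewrite !ge0_change_of_variables//.
- congr (_ - _)%E; apply: eq_integral => t _.
  + by rewrite !funeposE maxeMl// ?lee_fin ?mul0e// .
  + by rewrite !funenegE /= -mulNe maxeMl// ?lee_fin ?mul0e.
- exact: measurable_funeneg.
- exact: measurable_funepos.
Qed.

End change_of_variables.

(** * Expectations of products of independent samples *)

Section independent_samples.
Context d (T : measurableType d) (R : realType) (rho : probability T R).
Context dO (Omega : measurableType dO) (P : probability Omega R) (M : nat).
Context (x : 'I_M -> {mfun Omega >-> T}).
Hypothesis iid_x : iid_samples P rho x.

(** Independence is a statement on indicators, which are replaced by general
    functions one index at a time: if i is the next index, the measure sending
    A to the expectation of 1_A (x_i) times the other factors is a multiple of
    rho by induction, so its integrals are known. *)
Let product_expectation_upto k (f : 'I_M -> T -> R) (e : 'I_M -> R) :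
  (forall m, measurable_fun setT (f m)) -> (forall m t, 0 <= f m t) ->
  (forall m, \int[rho]_t (f m t)%:E = (e m)%:E)%E ->
  (forall m : 'I_M, (k <= m)%N ->
     exists2 A, measurable A & f m = \1_A) ->
  (\int[P]_w (\prod_(m < M) f m (x m w))%:E = (\prod_(m < M) e m)%:E)%E.
Proof.
have [indep law] := iid_x.
elim: k f e => [|k IHk] f e mf f0 fe find.
  have /choice [A fA] : forall m, exists A, measurable A /\ f m = \1_A.
    by move=> m; have [A mA ->] := find m isT; exists A.
  have mA m : measurable (A m) by case: (fA m).
  have eA m : (e m)%:E = P (x m @^-1` A m).
    rewrite law// -fe; under eq_integral do rewrite (fA m).2.
    by rewrite integral_indic// setIT.
  have mX m : measurable (x m @^-1` A m) by exact: measurable_funPTI.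
  rewrite -prodEFin; under [RHS]eq_bigr do rewrite eA.
  have := indep [set: 'I_M]%SET A mA.
  rewrite [X in _ = X -> _](eq_bigl xpredT); last by move=> m; rewrite finset.in_setT.
  move=> <-; set B := \bigcap_(_ in _) _.
  have BE w : (\prod_(m < M) f m (x m w) = \1_B w :> R).
    rewrite indicE; case: (boolP (w \in B)) => wB.
      rewrite big1// => m _; rewrite (fA m).2 indicE mem_set//.
      by move: wB; rewrite inE; apply; rewrite /= inE.
    have [m mw] : exists m, x m w \notin A m.
      apply/existsP; apply: contraNT wB => /existsPn wA.
      rewrite inE => m _; have := wA m; rewrite negbK inE; exact.
    by rewrite (bigD1 m)//= (fA m).2 indicE (negbTE mw) mul0r.
  under eq_integral do rewrite BE.
  rewrite integral_indic ?setIT//.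
  by apply: fin_bigcap_measurable => //; exact: finite_finset.
have [Mk|kM] := leqP M k.
  apply: (IHk f e) => // m km; have := ltn_ord m.
  by move=> /(leq_ltn_trans km); rewrite ltnNge Mk.
pose i := Ordinal kM; pose h w := \prod_(m < M | m != i) f m (x m w).
pose c := \prod_(m < M | m != i) e m.
have e0 m : 0 <= e m.
  by rewrite -lee_fin -fe; apply: integral_ge0 => t _; rewrite lee_fin.
have c0 : 0 <= c by apply: prodr_ge0.
have mfx m : measurable_fun setT (fun w => f m (x m w)).
  exact: measurableT_comp.
have mh : measurable_fun setT h.
  rewrite /h; under eq_fun do rewrite big_mkcond.
  apply: measurable_prod => m _; case: (m != i) => //.
have h0 w : 0 <= h w by apply: prodr_ge0.
have cE A : measurable A -> mscale (NngNum c0) rho A =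
    (\int[P]_(w in x i @^-1` A) (h w)%:E)%E.
  move=> mA; rewrite /mscale /=.
  pose g m := if m == i then \1_A else f m.
  pose e' m := if m == i then fine (rho A) else e m.
  have -> : (c%:E * rho A = (\prod_(m < M) e' m)%:E)%E.
    rewrite (bigD1 i)//= [in RHS]/e' eqxx mulrC EFinM fineK ?fin_num_measure//.
    congr (_%:E * _)%E; apply: eq_bigr => m /negbTE mi; by rewrite mi.
  rewrite -(IHk g e').
  - rewrite [RHS]integral_mkcond; apply: eq_integral => w _.
    rewrite patchE (bigD1 i)//=; have -> : g i = \1_A by rewrite /g eqxx.
    rewrite (eq_bigr (fun m => f m (x m w))) => [|m /negbTE mi]; last first.
      by rewrite /g mi.
    rewrite -/(h w) indicE; case: ifPn => wA.
      by rewrite (_ : x i w \in A) ?mul1r// inE; move: wA; rewrite inE.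
    rewrite (_ : x i w \in A = false) ?mul0r//; apply/negbTE.
    by apply: contra wA; rewrite !inE.
  - by move=> m; rewrite /g; case: ifP => // _; exact: measurable_indic.
  - by move=> m t; rewrite /g; case: ifP.
  - move=> m; rewrite /g /e'; case: ifP => // _.
    by rewrite integral_indic// setIT fineK ?fin_num_measure.
  - move=> m km; rewrite /g; case: eqP => [_|/eqP mi]; first by exists A.
    by apply: find; rewrite ltn_neqAle km andbT eq_sym.
have mxi : measurable_fun setT (x i) by [].
have := ge0_change_of_variables mh h0 mxi cE (g := fun t => (f i t)%:E).
rewrite ge0_integral_mscale//=; last 2 first.
- exact/measurable_EFinP.
- by move=> t _; rewrite lee_fin.
move=> E; rewrite [in RHS](bigD1 i)//= -/c mulrC EFinM -fe E//.
- by apply: eq_integral => w _; rewrite (bigD1 i)//= EFinM.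
- exact/measurable_EFinP.
- by move=> t; rewrite lee_fin.
Qed.

Lemma expectation_prod_samples (f : T -> R) (e : R) :
  measurable_fun setT f -> (forall t, 0 <= f t) ->
  (\int[rho]_t (f t)%:E = e%:E)%E ->
  (\int[P]_w (\prod_(m < M) f (x m w))%:E = (e ^+ M)%:E)%E.
Proof.
move=> mf f0 fe.
rewrite (product_expectation_upto (k := M) (f := fun=> f) (e := fun=> e))//.
  by rewrite prodr_const card_ord.
by move=> m; rewrite leqNgt ltn_ord.
Qed.

(** Markov's inequality for the exponential of the sum, which factors by
    independence. *)
Lemma chernoff_samples (f : T -> R) (a s : R) : measurable_fun setT f ->
  (\int[rho]_t (expR (f t))%:E <= (expR a)%:E)%E ->
  (P [set w | (s <= \sum_(m < M) f (x m w))%R] <= (expR (M%:R * a - s))%:E)%E.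
Proof.
move=> mf fa.
have mS : measurable_fun setT (fun w => \sum_(m < M) f (x m w)).
  by apply: measurable_sum => m; exact: measurableT_comp.
set A := [set w | _].
have mA : measurable A.
  rewrite /A -[X in measurable X]setTI.
  exact: (measurable_fun_ler (measurable_cst s) mS).
have me : measurable_fun setT (fun t => expR (f t)) by exact: measurableT_comp.
have efin : (\int[rho]_t (expR (f t))%:E)%E \is a fin_num.
  rewrite ge0_fin_numE; first exact: le_lt_trans fa (ltry _).
  by apply: integral_ge0 => t _; rewrite lee_fin expR_ge0.
pose e := fine (\int[rho]_t (expR (f t))%:E)%E.
have eE : (\int[rho]_t (expR (f t))%:E = e%:E)%E by rewrite fineK.
have e0 : 0 <= e.
  by apply: fine_ge0; apply: integral_ge0 => t _; rewrite lee_fin expR_ge0.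
have := expectation_prod_samples me (fun t => expR_ge0 _) eE.
have sE w : \prod_(m < M) expR (f (x m w)) = expR (\sum_(m < M) f (x m w)).
  by rewrite expR_sum.
under eq_integral do rewrite sE.
move=> SE; rewrite -[A]setIT -integral_indic//.
apply: (@le_trans _ _ (\int[P]_w
    ((expR (- s))%:E * (expR (\sum_(m < M) f (x m w)))%:E))%E).
  apply: ge0_le_integral => //.
  - exact/measurable_EFinP/measurable_indic.
  - apply/measurable_EFinP; apply: measurable_funM => //.
    exact: measurableT_comp.
  - move=> w _; rewrite -EFinM lee_fin indicE -expRD.
    case: (boolP (w \in A)); rewrite ?expR_ge0// inE => wA.
    by rewrite -expR0 ler_expR addrC subr_ge0.
rewrite ge0_integralZl//=; last first.
  by apply/measurable_EFinP; exact: measurableT_comp.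
rewrite SE -EFinM lee_fin addrC expRD ler_pM2l ?expR_gt0//.
rewrite expRM_natl; apply: lerXn2r; rewrite ?nnegrE ?expR_ge0//.
by rewrite -lee_fin -eE.
Qed.

End independent_samples.

(** * Exponential moments and tails of sample averages *)

Section exponential_moments.
Context (R : realType).
Implicit Types x y t : R.

(** From 1 - x/2 <= exp (- x/2) one gets exp x (1 - x/2)^2 <= 1, and
    (1 - x/2)^2 (1 + x + x^2) - 1 = x^2/4 (1 - 3 x + x^2) is nonnegative for
    x <= 1/3. *)
Lemma expR_le_quadratic x : `|x| <= 3^-1 -> expR x <= 1 + x + x ^+ 2.
Proof.
move=> x3; have [xl xu] : - 3^-1 <= x /\ x <= 3^-1 by apply/andP; rewrite -ler_norml.
have q0 : 0 <= 1 - x / 2 by lra.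
have ex : expR x * (1 - x / 2) ^+ 2 <= 1.
  rewrite [leRHS](_ : 1 = expR x * expR (- x / 2) ^+ 2); last first.
    by rewrite -expRM_natl -expRD -[LHS]expR0; congr expR; field.
  rewrite ler_pM2l ?expR_gt0// lerXn2r ?nnegrE ?expR_ge0//.
  by apply: (le_trans _ (expR_ge1Dx _)); rewrite mulNr.
have e0 := expR_gt0 x.
have p1 : 1 <= (1 - x / 2) ^+ 2 * (1 + x + x ^+ 2).
  rewrite -subr_ge0.
  have -> : (1 - x / 2) ^+ 2 * (1 + x + x ^+ 2) - 1 =
            x ^+ 2 / 4 * (1 - 3 * x + x ^+ 2) by field.
  by rewrite mulr_ge0 ?divr_ge0 ?sqr_ge0//; have := sqr_ge0 x; lra.
have p0 : 0 <= 1 + x + x ^+ 2 by have := sqr_ge0 x; lra.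
apply: (@le_trans _ _ (expR x * ((1 - x / 2) ^+ 2 * (1 + x + x ^+ 2)))).
  by rewrite -[leLHS]mulr1 ler_pM2l.
by rewrite mulrA -[leRHS]mul1r ler_wpM2r.
Qed.

(** For u >= 0 one has exp u <= 1 + u + u^2 exp u. With u = t y the factor
    y^2 exp (t y) is absorbed in 16 exp y, as y^2 <= 16 exp (y/2) and
    t <= 1/2. *)
Lemma expR_le_scaled t y : 0 <= t <= 2^-1 -> 0 <= y ->
  expR (t * y) <= 1 + t * y + 16 * t ^+ 2 * expR y.
Proof.
move=> /andP[t0 t2] y0.
have remainder x : 0 <= x -> expR x <= 1 + x + x ^+ 2 * expR x.
  move=> x0; have e1 : expR x * (1 - x) <= 1.
    rewrite -[leRHS](expRxMexpNx_1 x) ler_pM2l ?expR_gt0//.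
    by exact: (le_trans _ (expR_ge1Dx _)).
  have e2 : x * (expR x * (1 - x)) <= x by rewrite -[leRHS]mulr1 ler_wpM2l.
  rewrite -subr_ge0; move: (lerD e1 e2); rewrite -subr_ge0.
  by congr (0 <= _); ring.
apply: le_trans (remainder _ (mulr_ge0 t0 y0)) _.
rewrite lerD2l exprMn -(mulrA (t ^+ 2)) -(mulrA 16) [leRHS]mulrCA.
rewrite ler_wpM2l ?sqr_ge0//.
have y4 : y ^+ 2 <= 16 * expR (y / 2).
  have -> : expR (y / 2) = expR (y / 4) ^+ 2.
    by rewrite -expRM_natl; congr expR; field.
  have -> : y ^+ 2 = 16 * (y / 4) ^+ 2 by field.
  rewrite ler_pM2l// lerXn2r ?nnegrE ?expR_ge0 ?divr_ge0//.
  by apply: (le_trans _ (expR_ge1Dx _)); rewrite lerDr.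
have ty : expR (t * y) <= expR (y / 2).
  by rewrite ler_expR mulrC ler_wpM2l.
apply: (@le_trans _ _ ((16 * expR (y / 2)) * expR (y / 2))).
  by apply: ler_pM => //; rewrite ?sqr_ge0 ?expR_ge0.
by rewrite -mulrA -expRD -splitr.
Qed.

End exponential_moments.

Lemma EFin_integralZl d (T : measurableType d) (R : realType)
    (m : {measure set T -> \bar R}) (k : R) (g : T -> R) :
  measurable_fun setT g -> (forall y, 0 <= g y) -> 0 <= k ->
  (\int[m]_y (k%:E * (g y)%:E) = k%:E * \int[m]_y (g y)%:E)%E.
Proof.
move=> mg g0 k0; apply: ge0_integralZl => //; try exact/measurable_EFinP.
by move=> *; rewrite lee_fin.
Qed.

Section sample_tails.
Context d (T : measurableType d) (R : realType) (rho : probability T R).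
Context dO (Omega : measurableType dO) (P : probability Omega R) (M : nat).
Context (x : 'I_M -> {mfun Omega >-> T}).
Hypothesis iid_x : iid_samples P rho x.

(** Optimizing over l gives the exponent - M t^2 / (4 v). The function is not
    centered: its mean is the linear term in exp u <= 1 + u + u^2, so v bounds
    the second moment instead of the variance. *)
Lemma second_moment_tail (f : T -> R) (a B v l t : R) :
  rho.-integrable setT (EFin \o f) ->
  (\int[rho]_y (f y)%:E = a%:E)%E ->
  (\int[rho]_y (f y ^+ 2)%:E <= v%:E)%E ->
  {ae rho, forall y, `|f y| <= B} ->
  0 < l -> l * B <= 3^-1 ->
  (P [set w | (M%:R * (a + t) <= \sum_(m < M) f (x m w))%R]
     <= (expR (M%:R * (l ^+ 2 * v - l * t)))%:E)%E.
Proof.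
move=> intf fa fv fB l0 lB.
have mf : measurable_fun setT f by apply/measurable_EFinP; case/integrableP: intf.
have mf2 : measurable_fun setT (fun y => f y ^+ 2) by exact: measurable_funX.
have intf2 : rho.-integrable setT (fun y => (f y ^+ 2)%:E).
  apply/integrableP; split; first exact/measurable_EFinP.
  under eq_integral do rewrite abse_EFin ger0_norm ?sqr_ge0//.
  exact: le_lt_trans fv (ltry _).
have exp_moment : (\int[rho]_y (expR (l * f y))%:E
    <= (expR (l * a + l ^+ 2 * v))%:E)%E.
  apply: (@le_trans _ _ (\int[rho]_y
      ((1 + l * f y)%:E + (l ^+ 2)%:E * (f y ^+ 2)%:E))%E).
    apply: ae_ge0_le_integral => //.
    - by apply/measurable_EFinP; apply: measurableT_comp => //;
         exact: measurable_funM.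
    - move=> y _; rewrite -EFinM -EFinD lee_fin -exprMn.
      by have := sqr_ge0 (l * f y + 2^-1); have := sqr_ge0 (l * f y); nra.
    - apply: emeasurable_funD; apply/measurable_EFinP.
        by apply: measurable_funD => //; exact: measurable_funM.
      by apply: measurable_funM.
    apply: filterS fB => y fB _.
    rewrite -EFinM -EFinD lee_fin -exprMn expR_le_quadratic//.
    by rewrite normrM (gtr0_norm l0) (le_trans _ lB)// ler_pM2l.
  have int1 : rho.-integrable setT (cst (1%:E : \bar R)).
    exact: finite_measure_integrable_cst.
  have intlf : rho.-integrable setT (fun y => l%:E * (f y)%:E)%E.
    exact: integrableZl.
  have int1lf : rho.-integrable setT (fun y => (1 + l * f y)%:E).
    have := integrableD measurableT int1 intlf.
    by apply: eq_integrable => // y _ /=; rewrite -EFinM -EFinD.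
  rewrite integralD//; last exact: integrableZl.
  have -> : (\int[rho]_y (1 + l * f y)%:E = (1 + l * a)%:E)%E.
    under eq_integral do rewrite EFinD EFinM.
    rewrite integralD// integral_cst// [X in (_ * X + _)%E]probability_setT mule1.
    by rewrite integralZl// fa -EFinM -EFinD.
  rewrite integralZl//.
  apply: (@le_trans _ _ ((1 + l * a)%:E + (l ^+ 2 * v)%:E)%E).
    by rewrite leeD2l// [leRHS]EFinM lee_wpmul2l// lee_fin sqr_ge0.
  by rewrite -EFinD lee_fin -addrA expR_ge1Dx.
have mlf : measurable_fun setT (fun y => l * f y) by exact: measurable_funM.
have := chernoff_samples iid_x (l * (M%:R * (a + t))) mlf exp_moment.
set A := [set w | _]; set A' := [set w | _].
have -> : A = A'.
  by apply/seteqP; split => w; rewrite /A /A' /= -mulr_sumr ler_pM2l.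
move=> /le_trans; apply; rewrite lee_fin ler_expR.
by have -> : M%:R * (l * a + l ^+ 2 * v) - l * (M%:R * (a + t)) =
  M%:R * (l ^+ 2 * v - l * t) by ring.
Qed.

(** Since y <= exp y, a mean is at most twice any admissible psi_1 scale. *)
Lemma integral_le_orlicz (f : T -> R) (c : R) : 0 < c ->
  measurable_fun setT f -> (forall y, 0 <= f y) ->
  (\int[rho]_y (expR (f y / c))%:E <= 2%:E)%E ->
  (\int[rho]_y (f y)%:E <= (2 * c)%:E)%E.
Proof.
move=> c0 mf f0 fc.
have me : measurable_fun setT (fun y => expR (f y / c)).
  by apply: measurableT_comp => //; exact: measurable_funM.
apply: (@le_trans _ _ (\int[rho]_y (c%:E * (expR (f y / c))%:E))%E).
  apply: ge0_le_integral => //.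
  - by move=> y _; rewrite lee_fin.
  - exact/measurable_EFinP.
  - by apply/measurable_EFinP; exact: measurable_funM.
  - move=> y _; rewrite -EFinM lee_fin -ler_pdivrMl// mulrC.
    by apply: (le_trans _ (expR_ge1Dx _)); rewrite lerDr.
rewrite EFin_integralZl//; last exact: ltW.
by rewrite mulrC EFinM lee_wpmul2l// lee_fin ltW.
Qed.

(** The exponential moment at t = 1 / (2 sqrt M) costs 32 t^2 per sample, that
    is 8 in total, while the deviation s gains sqrt M s / (2 c). Such a fixed t
    suffices for a bound of the form ln (6 / xi) / sqrt M. *)
Lemma subexponential_tail (f : T -> R) (a c s : R) : (0 < M)%N -> 0 < c ->
  measurable_fun setT f -> (forall y, 0 <= f y) ->
  (\int[rho]_y (f y)%:E = a%:E)%E ->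
  (\int[rho]_y (expR (f y / c))%:E <= 2%:E)%E ->
  (P [set w | (M%:R * (a + s) <= \sum_(m < M) f (x m w))%R]
     <= (expR (8 - Num.sqrt M%:R * s / (2 * c)))%:E)%E.
Proof.
move=> M0 c0 mf f0 fa fc.
have : Num.sqrt (M%:R : R) ^+ 2 = M%:R by rewrite sqr_sqrtr.
have : 1 <= Num.sqrt (M%:R : R) by rewrite -[leLHS]sqrtr1 ler_wsqrtr ?ler1n.
move: (Num.sqrt _) => r r1 r2.
have r0 : 0 < r by exact: lt_le_trans r1.
have [t tE] : {t : R | t = (2 * r)^-1} by exists (2 * r)^-1.
have t0 : 0 < t by rewrite tE invr_gt0 mulr_gt0.
have t2 : 0 <= t <= 2^-1.
  by rewrite ltW//= tE lef_pV2 ?posrE ?mulr_gt0// ler_peMr.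
have mfc : measurable_fun setT (fun y => f y / c) by exact: measurable_funM.
have mtf : measurable_fun setT (fun y => t * (f y / c)) by exact: measurable_funM.
have me : measurable_fun setT (fun y => expR (f y / c)).
  exact: measurableT_comp.
have exp_moment : (\int[rho]_y (expR (t * (f y / c)))%:E
    <= (expR (t * (a / c) + 32 * t ^+ 2))%:E)%E.
  apply: (@le_trans _ _ (\int[rho]_y (1%:E + ((t / c)%:E * (f y)%:E
      + (16 * t ^+ 2)%:E * (expR (f y / c))%:E)))%E).
    apply: ge0_le_integral => //.
    - by apply/measurable_EFinP; exact: measurableT_comp.
    - apply/measurable_EFinP; apply: measurable_funD => //.
      by apply: measurable_funD; exact: measurable_funM.
    move=> y _; rewrite -!EFinM -!EFinD lee_fin.
    have := expR_le_scaled t2 (divr_ge0 (f0 y) (ltW c0)).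
    have -> : t / c * f y = t * (f y / c) by ring.
    by move=> h; rewrite [leRHS]addrA.
  have tc0 : 0 <= t / c by rewrite divr_ge0// ltW.
  have t20 : 0 <= 16 * t ^+ 2 by rewrite mulr_ge0// sqr_ge0.
  rewrite ge0_integralD//; last 2 first.
  - by move=> y _; rewrite adde_ge0// -EFinM lee_fin mulr_ge0// expR_ge0.
  - apply/measurable_EFinP; apply: measurable_funD; exact: measurable_funM.
  rewrite ge0_integralD//; last 4 first.
  - by move=> y _; rewrite -EFinM lee_fin mulr_ge0.
  - by apply/measurable_EFinP; exact: measurable_funM.
  - by move=> y _; rewrite -EFinM lee_fin mulr_ge0// expR_ge0.
  - by apply/measurable_EFinP; exact: measurable_funM.
  rewrite integral_cst// [X in (_ * X + _)%E]probability_setT mule1.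
  rewrite !EFin_integralZl ?fa//.
  apply: (@le_trans _ _ (1%:E + ((t / c * a)%:E + (16 * t ^+ 2 * 2)%:E))%E).
    by rewrite leeD2l// leeD2l// [leRHS]EFinM lee_wpmul2l// lee_fin.
  rewrite -!EFinD lee_fin.
  have -> : t / c * a + 16 * t ^+ 2 * 2 = t * (a / c) + 32 * t ^+ 2 by ring.
  exact: expR_ge1Dx.
have := chernoff_samples iid_x (t / c * (M%:R * (a + s))) mtf exp_moment.
set A := [set w | _]; set A' := [set w | _].
have -> : A = A'.
  apply/seteqP; split => w; rewrite /A /A' /= -mulr_sumr -mulr_suml;
    by rewrite -mulrA ler_pM2l// [c^-1 * _]mulrC ler_pM2r ?invr_gt0.
move=> /le_trans; apply; rewrite lee_fin ler_expR.
rewrite -r2 tE le_eqVlt; apply/orP; left; apply/eqP; field.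
by rewrite !gt_eqF.
Qed.

End sample_tails.

(** * Exceptional events *)

Section exceptional_events.
Context d (Omega : measurableType d) (R : realType) (P : probability Omega R).
Implicit Types (p q : R) (A B : Omega -> Prop).

(** Measurability is required of an exceptional event only, so that A may be
    any property of the outcome. *)
Definition fails_with_prob_le p A : Prop :=
  exists E : set Omega,
    [/\ measurable E, (P E <= p%:E)%E & forall w, ~ E w -> A w].

Lemma fails_with_prob_leW p q A B : p <= q -> (forall w, A w -> B w) ->
  fails_with_prob_le p A -> fails_with_prob_le q B.
Proof.
move=> pq AB [E [mE PE EA]]; exists E; split => //.
  by apply: le_trans PE _; rewrite lee_fin.
by move=> w /EA/AB.
Qed.

Lemma fails_with_prob_le_and p q A B :
  fails_with_prob_le p A -> fails_with_prob_le q B ->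
  fails_with_prob_le (p + q) (fun w => A w /\ B w).
Proof.
move=> [E [mE PE EA]] [F [mF PF FB]]; exists (E `|` F); split.
- exact: measurableU.
- by rewrite EFinD; apply: le_trans (measureU2 _ _ _) _ => //; exact: leeD.
- by move=> w EFw; split; [apply: EA|apply: FB] => ?; apply: EFw; [left|right].
Qed.

Lemma fails_with_prob_le_all (I : finType) (p : R) (A : I -> Omega -> Prop) :
  (forall i, fails_with_prob_le p (A i)) ->
  fails_with_prob_le (#|I|%:R * p) (fun w => forall i, A i w).
Proof.
move=> PA.
suff: fails_with_prob_le ((size (enum I))%:R * p)
    (fun w => forall i, i \in enum I -> A i w).
  apply: fails_with_prob_leW; first by rewrite -cardE.
  by move=> w Aw i; apply: Aw; rewrite mem_enum.
elim: (enum I) => [|i s IHs].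
  exists set0; split => //=.
  by rewrite measure0 mul0r.
apply: fails_with_prob_leW (fails_with_prob_le_and (PA i) IHs).
  by rewrite /= -addn1 natrD mulrDl mul1r addrC.
by move=> w [Ai As] j; rewrite inE => /orP[/eqP->|/As].
Qed.

Lemma fails_with_prob_le_lt p (f : Omega -> R) (s : R) :
  measurable_fun setT f -> (P [set w | (s <= f w)%R] <= p%:E)%E ->
  fails_with_prob_le p (fun w => f w < s).
Proof.
move=> mf Pf; exists [set w | s <= f w]; split => //.
  rewrite -[X in measurable X]setTI.
  exact: (measurable_fun_ler (measurable_cst s) mf).
by move=> w /negP; rewrite -ltNge.
Qed.

End exceptional_events.

Lemma samples_avoid d (T : measurableType d) (R : realType)
    (rho : probability T R) dO (Omega : measurableType dO)
    (P : probability Omega R) M (x : 'I_M -> {mfun Omega >-> T})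
    (A : set T) (p : R) :
  iid_samples P rho x -> measurable A -> (rho A <= p%:E)%E ->
  fails_with_prob_le P (M%:R * p) (fun w => forall m, ~ A (x m w)).
Proof.
move=> [_ law] mA rhoA; rewrite -[M in M%:R]card_ord.
apply: fails_with_prob_le_all => m; exists (x m @^-1` A); split => //.
- exact: measurable_funPTI.
- by rewrite law.
Qed.

Lemma second_moment_deviation d (T : measurableType d) (R : realType)
    (rho : probability T R) dO (Omega : measurableType dO)
    (P : probability Omega R) M (x : 'I_M -> {mfun Omega >-> T})
    (f : T -> R) (a B v l t : R) :
  iid_samples P rho x ->
  rho.-integrable setT (EFin \o f) ->
  (\int[rho]_y (f y)%:E = a%:E)%E ->
  (\int[rho]_y (f y ^+ 2)%:E <= v%:E)%E ->
  {ae rho, forall y, `|f y| <= B} ->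
  0 < l -> l * B <= 3^-1 ->
  fails_with_prob_le P (2 * expR (M%:R * (l ^+ 2 * v - l * t)))
    (fun w => `|\sum_(m < M) f (x m w) - M%:R * a| < M%:R * t).
Proof.
move=> iid_x intf fa fv fB l0 lB.
have mf : measurable_fun setT f by apply/measurable_EFinP; case/integrableP: intf.
have up := second_moment_tail iid_x t intf fa fv fB l0 lB.
have intNf : rho.-integrable setT (EFin \o (fun y => - f y)).
  by have := integrableN intf.
have down := second_moment_tail iid_x t intNf (a := - a) _ _ _ l0 lB.
have mS (g : T -> R) : measurable_fun setT g ->
    measurable_fun setT (fun w => \sum_(m < M) g (x m w)).
  by move=> mg; apply: measurable_sum => m; exact: measurableT_comp.
rewrite mulrDl mul1r.
apply: fails_with_prob_leW (fails_with_prob_le_and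
  (fails_with_prob_le_lt _ up) (fails_with_prob_le_lt _ (down v _ _ _))) => //.
- move=> w [upw]; rewrite sumrN => downw.
  by rewrite ltr_norml; apply/andP; split; lra.
- exact: mS.
- by apply: (mS (fun y => - f y)); exact: measurable_funN.
- under eq_integral do rewrite -mulN1r EFinM.
  by rewrite integralZl// fa -EFinM mulN1r.
- by under eq_integral do rewrite sqrrN.
- by apply: filterS fB => y; rewrite normrN.
Qed.

(** * Complex vectors and perturbation of matrices *)

Section complex_modulus.
Context (R : realType).
Implicit Types (y z : R[i]).
Local Open Scope complex_scope.

Lemma cabs_ge0 z : 0 <= cabs z.
Proof. by case: z => a b; rewrite sqrtr_ge0. Qed.

Lemma cabs_sqr z : cabs z ^+ 2 = complex.Re z ^+ 2 + complex.Im z ^+ 2.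
Proof. by case: z => a b; rewrite sqr_sqrtr// addr_ge0 ?sqr_ge0. Qed.

Lemma cabs0 : cabs (0 : R[i]) = 0.
Proof. exact: ComplexField.Normc.normc0. Qed.

Lemma cabs_eq0 z : (cabs z == 0) = (z == 0).
Proof.
apply/eqP/eqP => [|->]; last exact: cabs0.
exact: ComplexField.Normc.eq0_normc.
Qed.

Lemma cabsM y z : cabs (y * z) = cabs y * cabs z.
Proof. exact: ComplexField.Normc.normcM. Qed.

Lemma cabs_conj z : cabs z^* = cabs z.
Proof. by case: z => a b; rewrite /cabs /= sqrrN. Qed.

Lemma cabs_real (r : R) : 0 <= r -> cabs r%:C = r.
Proof.
by move=> r0; rewrite /cabs /= expr0n /= addr0 sqrtr_sqr ger0_norm.
Qed.

Lemma cabs_real_inv (r : R) : 0 <= r -> cabs (r%:C)^-1 = r^-1.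
Proof.
move=> r0; rewrite -[in RHS](cabs_real r0).
exact: ComplexField.Normc.normcV.
Qed.

Lemma le_cabsD y z : cabs (y + z) <= cabs y + cabs z.
Proof. exact: le_normcD. Qed.

Lemma le_cabs_sum (I : Type) (s : seq I) (F : I -> R[i]) :
  cabs (\sum_(i <- s) F i) <= \sum_(i <- s) cabs (F i).
Proof.
elim/big_ind2 : _ => //; first by rewrite cabs0.
by move=> ? ? ? ? h1 h2; exact: le_trans (le_cabsD _ _) (lerD h1 h2).
Qed.

(** Young's form of the triangle inequality, which keeps perturbation
    estimates at the level of squared norms. *)
Lemma cabs_sqrD_le (s : R) y z : 0 < s ->
  cabs (y + z) ^+ 2 <= (1 + s) * cabs y ^+ 2 + (1 + s^-1) * cabs z ^+ 2.
Proof.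
move=> s0; apply: (@le_trans _ _ ((cabs y + cabs z) ^+ 2)).
  by rewrite lerXn2r ?nnegrE ?addr_ge0 ?cabs_ge0// le_cabsD.
move: (cabs y) (cabs z) => a b; rewrite -subr_ge0.
have -> : (1 + s) * a ^+ 2 + (1 + s^-1) * b ^+ 2 - (a + b) ^+ 2 =
          s * (a - b / s) ^+ 2 by field; rewrite gt_eqF.
by rewrite mulr_ge0 ?sqr_ge0// ltW.
Qed.

Lemma conjM_cabs z : z^* * z = (cabs z ^+ 2)%:C.
Proof.
rewrite cabs_sqr; case: z => a b; simpc => /=.
by congr (_ +i* _); ring.
Qed.

(** Real and imaginary parts as one family, so that complex coordinates are
    treated as pairs of real ones. *)
Definition part (b : bool) z : R := if b then complex.Im z else complex.Re z.

Lemma partE b z : part b z = complex.Re ((if b then - 'i else 1) * z).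
Proof. by case: b; case: z => a c; simpc; rewrite /= ?mul0r ?mul1r ?sub0r ?opprK. Qed.

Lemma partD b y z : part b (y + z) = part b y + part b z.
Proof. by case: b; case: y z => [? ?] [? ?]. Qed.

Lemma part_sum b (I : Type) (s : seq I) (F : I -> R[i]) :
  part b (\sum_(i <- s) F i) = \sum_(i <- s) part b (F i).
Proof.
elim: s => [|i s IHs]; first by rewrite !big_nil; case: b.
by rewrite !big_cons -IHs partD.
Qed.

Lemma partZ b (r : R) z : part b (r%:C * z) = r * part b z.
Proof. by case: b; case: z => ? ?; simpc. Qed.

Lemma partN b z : part b (- z) = - part b z.
Proof. by case: b; case: z => ? ?. Qed.

Lemma cabs_sqr_parts z : cabs z ^+ 2 = part true z ^+ 2 + part false z ^+ 2.
Proof. by rewrite cabs_sqr addrC. Qed.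

Lemma norm_part_le b z : `|part b z| <= cabs z.
Proof.
rewrite -(ler_pXn2r (n := 2))// ?nnegrE ?cabs_ge0//.
by rewrite cabs_sqr_parts real_normK ?num_real//; case: b;
  rewrite ?lerDl ?lerDr sqr_ge0.
Qed.

Definition sqnorm n (c : 'I_n -> R[i]) : R := \sum_(i < n) cabs (c i) ^+ 2.

Lemma sqnorm_ge0 n (c : 'I_n -> R[i]) : 0 <= sqnorm c.
Proof. by apply: sumr_ge0 => i _; exact: sqr_ge0. Qed.

Lemma cabs_sqr_le_sqnorm n (c : 'I_n -> R[i]) i : cabs (c i) ^+ 2 <= sqnorm c.
Proof.
rewrite /sqnorm (bigD1 i)//= lerDl.
by apply: sumr_ge0 => j _; exact: sqr_ge0.
Qed.

Lemma sqnorm_eq0 n (c : 'I_n -> R[i]) : sqnorm c = 0 -> forall i, c i = 0.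
Proof.
move=> c0 i; apply/eqP; rewrite -cabs_eq0 -sqrf_eq0.
by rewrite eq_le sqr_ge0 -c0 cabs_sqr_le_sqnorm.
Qed.

(** With A, B, C the three sums, the squares (B x_i - C y_i)^2 add up to
    B (A B - C^2). *)
Lemma cauchy_schwarz_sum n (x y : 'I_n -> R) :
  (\sum_(i < n) x i * y i) ^+ 2 <=
  (\sum_(i < n) x i ^+ 2) * (\sum_(i < n) y i ^+ 2).
Proof.
set A := \sum_i x i ^+ 2; set B := \sum_i y i ^+ 2; set C := \sum_i x i * y i.
have B0 : 0 <= B by apply: sumr_ge0 => i _; exact: sqr_ge0.
have E : \sum_(i < n) (B * x i - C * y i) ^+ 2 = B * (A * B - C ^+ 2).
  transitivity (\sum_(i < n)
      (B ^+ 2 * x i ^+ 2 - 2 * B * C * (x i * y i) + C ^+ 2 * y i ^+ 2)).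
    by apply: eq_bigr => i _; ring.
  by rewrite big_split /= sumrB -!mulr_sumr -/A -/B -/C; ring.
have : 0 <= \sum_(i < n) (B * x i - C * y i) ^+ 2.
  by apply: sumr_ge0 => i _; exact: sqr_ge0.
rewrite E; have [B1|B1] := ltP 0 B; first by rewrite pmulr_rge0// subr_ge0.
have {B1} Beq : B = 0 by apply/eqP; rewrite eq_le B1 B0.
have y0 i : y i = 0.
  apply/eqP; rewrite -sqrf_eq0; apply/eqP.
  have /eqP := Beq; rewrite /B psumr_eq0; last by move=> *; exact: sqr_ge0.
  by move=> /allP /(_ i (mem_index_enum _)) /eqP.
move=> _; rewrite {1}/C big1 ?expr0n/= ?Beq ?mulr0// => i _.
by rewrite y0 mulr0.
Qed.

Lemma cauchy_schwarz_cabs n (c e : 'I_n -> R[i]) :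
  cabs (\sum_(i < n) c i * e i) ^+ 2 <= sqnorm c * sqnorm e.
Proof.
apply: le_trans (cauchy_schwarz_sum (fun i => cabs (c i)) (fun i => cabs (e i))).
rewrite lerXn2r ?nnegrE ?cabs_ge0//.
  by apply: sumr_ge0 => i _; rewrite mulr_ge0 ?cabs_ge0.
by apply: le_trans (le_cabs_sum _ _) _; apply: ler_sum => i _; rewrite cabsM.
Qed.

End complex_modulus.

Section perturbation.
Context (R : realType) (N : nat).
Implicit Types (u v l : 'rV[R[i]]_N) (G E : 'M[R[i]]_N).

Local Notation rnorm v := (sqnorm (v ord0)).

Lemma sqnorm_mulmx_le v E :
  rnorm (v *m E) <= rnorm v * \sum_(j < N) sqnorm (E ^~ j).
Proof.
rewrite /sqnorm mulr_sumr; apply: ler_sum => j _.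
by rewrite mxE; exact: cauchy_schwarz_cabs.
Qed.

Context (G : 'M[R[i]]_N) (e : R).
Hypothesis e01 : 0 < e < 1.
Hypothesis GE : \sum_(j < N) sqnorm ((G - 1%:M) ^~ j) <= e ^+ 2.

(** Splitting v by [cabs_sqrD_le] with s = e / (1 - e) gives
    |v|^2 <= |u|^2 / (1 - e) + e |v|^2, hence |v| <= |u| / (1 - e), the bound
    of the Neumann series. *)
Lemma fixpoint_bound u v : v = u - v *m (G - 1%:M) ->
  rnorm v <= rnorm u / (1 - e) ^+ 2.
Proof.
have [e0 e1] := andP e01; have e1' : 0 < 1 - e by rewrite subr_gt0.
move=> vE; set w := - (v *m (G - 1%:M)).
have w_le : rnorm w <= e ^+ 2 * rnorm v.
  rewrite /w -mulNmx mulrC; apply: le_trans (sqnorm_mulmx_le _ _) _.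
  have -> : rnorm (- v) = rnorm v.
    by apply: eq_bigr => i _; rewrite mxE /cabs normcN.
  by rewrite ler_wpM2l ?sqnorm_ge0.
have s0 : 0 < e / (1 - e) by rewrite divr_gt0.
have : rnorm v <= (1 - e)^-1 * rnorm u + e^-1 * rnorm w.
  rewrite {1}vE /sqnorm !mulr_sumr -big_split/=.
  apply: ler_sum => i _; rewrite mxE -/w.
  have -> : (1 - e)^-1 = 1 + e / (1 - e) by field; rewrite gt_eqF.
  have -> : e^-1 = 1 + (e / (1 - e))^-1 by field; rewrite !gt_eqF.
  exact: cabs_sqrD_le.
have : e^-1 * rnorm w <= e * rnorm v.
  rewrite ler_pdivrMl// (le_trans w_le)// le_eqVlt.
  by apply/orP; left; apply/eqP; ring.
move=> h1 h2; rewrite ler_pdivlMr ?exprn_gt0//.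
have h3 : (1 - e) * rnorm v <= (1 - e)^-1 * rnorm u by lra.
rewrite mulrC expr2 -mulrA -ler_pdivlMl//; exact: h3.
Qed.

(** A row v in the kernel of G satisfies v = 0 - v (G - 1). *)
Lemma unitmx_perturbation : G \in unitmx.
Proof.
rewrite unitmxE unitfE; apply/det0P => -[v v0 vG].
have : rnorm v <= rnorm (0 : 'rV[R[i]]_N) / (1 - e) ^+ 2.
  by apply: fixpoint_bound; rewrite mulmxBr vG mulmx1 !sub0r opprK.
have -> : rnorm (0 : 'rV[R[i]]_N) = 0 by apply: big1 => i _; rewrite mxE cabs0 expr0n.
rewrite mul0r => v_le0; move/eqP: v0; apply.
apply/matrixP => i j; rewrite (ord1 i) mxE.
have [v_eq0] : rnorm v = 0 by apply/eqP; rewrite eq_le v_le0 sqnorm_ge0.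
exact: sqnorm_eq0 v_eq0 j.
Qed.

(** The difference b = l G^-1 - l solves b = (l - l G) - b (G - 1). *)
Lemma inverse_perturbation l :
  rnorm (l *m invmx G - l) <= rnorm (l *m G - l) / (1 - e) ^+ 2.
Proof.
rewrite -(_ : rnorm (l - l *m G) = rnorm (l *m G - l)); last first.
  by apply: eq_bigr => i _; rewrite -opprB mxE /cabs normcN.
apply: fixpoint_bound.
rewrite mulmxBr mulmx1 mulmxBl mulmxKV ?unitmx_perturbation//.
by rewrite [X in _ = _ + X]opprB [RHS]addrC subrK.
Qed.

End perturbation.

(** * Integrals of sesquilinear forms in an orthonormal system *)

Section measurability.
Context d (T : measurableType d) (R : realType) (D : set T).
Hypothesis mD : measurable D.
Implicit Types (u v : T -> R[i]) (f : T -> R).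
Local Open Scope complex_scope.

Lemma measurable_inv_ge0 f : measurable_fun D f ->
  (forall x, D x -> 0 <= f x) -> measurable_fun D (fun x => (f x)^-1).
Proof.
move=> mf f0.
apply: (@eq_measurable_fun _ _ _ _ _ (fun x => (f x) `^ (-1))).
  by move=> x /[!inE] Dx; rewrite powR_inv1// f0.
exact: (measurableT_comp (measurable_powR (-1)) mf).
Qed.

Lemma measurable_sqrt f : measurable_fun D f ->
  measurable_fun D (fun x => Num.sqrt (f x)).
Proof.
move=> mf; apply: (measurableT_comp _ mf).
exact: continuous_measurable_fun (@sqrt_continuous R).
Qed.

Lemma cmeasurable_cst (c : R[i]) : cmeasurable_fun D (fun=> c).
Proof. by split; exact: measurable_cst. Qed.

Lemma cmeasurableD u v : cmeasurable_fun D u -> cmeasurable_fun D v ->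
  cmeasurable_fun D (fun x => u x + v x).
Proof.
move=> [ru iu] [rv iv]; split.
  apply: (@eq_measurable_fun _ _ _ _ _
    (fun x => complex.Re (u x) + complex.Re (v x))).
    by move=> x _; case: (u x) (v x) => [a b] [a' b'].
  exact: measurable_funD.
apply: (@eq_measurable_fun _ _ _ _ _
  (fun x => complex.Im (u x) + complex.Im (v x))).
  by move=> x _; case: (u x) (v x) => [a b] [a' b'].
exact: measurable_funD.
Qed.

Lemma cmeasurableM u v : cmeasurable_fun D u -> cmeasurable_fun D v ->
  cmeasurable_fun D (fun x => u x * v x).
Proof.
move=> [ru iu] [rv iv]; split.
  apply: (@eq_measurable_fun _ _ _ _ _
    (fun x => complex.Re (u x) * complex.Re (v x)
            - complex.Im (u x) * complex.Im (v x))).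
    by move=> x _; case: (u x) (v x) => [a b] [a' b'].
  by apply: measurable_funB; exact: measurable_funM.
apply: (@eq_measurable_fun _ _ _ _ _
  (fun x => complex.Re (u x) * complex.Im (v x)
          + complex.Im (u x) * complex.Re (v x))).
  by move=> x _; case: (u x) (v x) => [a b] [a' b'].
by apply: measurable_funD; exact: measurable_funM.
Qed.

Lemma cmeasurable_conj u : cmeasurable_fun D u ->
  cmeasurable_fun D (fun x => (u x)^*).
Proof.
move=> [ru iu]; split.
  apply: (@eq_measurable_fun _ _ _ _ _ (fun x => complex.Re (u x))) => //.
  by move=> x _; case: (u x).
apply: (@eq_measurable_fun _ _ _ _ _ (fun x => - complex.Im (u x))).
  by move=> x _; case: (u x).
exact: measurable_funN.
Qed.

Lemma cmeasurable_sum (I : Type) (s : seq I) (F : I -> T -> R[i]) :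
  (forall i, cmeasurable_fun D (F i)) ->
  cmeasurable_fun D (fun x => \sum_(i <- s) F i x).
Proof.
move=> mF; elim: s => [|i s IHs].
  by under eq_fun do rewrite big_nil; exact: cmeasurable_cst.
by under eq_fun do rewrite big_cons; exact: cmeasurableD.
Qed.

Lemma measurable_cabs u : cmeasurable_fun D u ->
  measurable_fun D (fun x => cabs (u x)).
Proof.
move=> [ru iu]; apply: (@eq_measurable_fun _ _ _ _ _
  (fun x => Num.sqrt (complex.Re (u x) ^+ 2 + complex.Im (u x) ^+ 2))).
  by move=> x _; case: (u x).
by apply: measurable_sqrt; apply: measurable_funD; exact: measurable_funX.
Qed.

End measurability.

Section gram_integrals.
Context d (T : measurableType d) (R : realType).
Context (mu : {measure set T -> \bar R}) (D : set T) (N : nat).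
Context (phi : 'I_N -> T -> R[i]).
Hypothesis mD : measurable D.
Hypothesis orthonormal_phi : orthonormal_system mu D phi.
Local Open Scope complex_scope.

Let mphi n : cmeasurable_fun D (phi n).
Proof. by case: orthonormal_phi => /(_ n) []. Qed.

Let pairing i j x : R[i] := (phi i x)^* * phi j x.

Let mpairing i j : cmeasurable_fun D (pairing i j).
Proof. by apply: cmeasurableM => //; exact: cmeasurable_conj. Qed.

Let pairing_integrable i j :
  mu.-integrable D (EFin \o (fun x => complex.Re (pairing i j x))) /\
  mu.-integrable D (EFin \o (fun x => complex.Im (pairing i j x))).
Proof.
have [mre mim] := mpairing i j.
have [L2 _] := orthonormal_phi.
have intsq n : mu.-integrable D (EFin \o (fun x => cabs (phi n x) ^+ 2)).
  have [_ fin] := L2 n; apply/integrableP; split.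
    by apply/measurable_EFinP; apply: measurable_funX; exact: measurable_cabs.
  by under eq_integral do rewrite /= ger0_norm ?sqr_ge0//.
have intsum := integrableD mD (intsq i) (intsq j).
have bound x : cabs (pairing i j x) <= cabs (phi i x) ^+ 2 + cabs (phi j x) ^+ 2.
  rewrite cabsM cabs_conj.
  move: (cabs_ge0 (phi i x)) (cabs_ge0 (phi j x)).
  move: (cabs _) (cabs _) => a b a0 b0.
  by have := sqr_ge0 (a - b); nra.
have dominated (f : T -> R) : measurable_fun D f ->
    (forall x, `|f x| <= cabs (pairing i j x)) -> mu.-integrable D (EFin \o f).
  move=> mf f_le; apply: (le_integrable mD _ _ intsum).
    exact/measurable_EFinP.
  move=> x _; apply: (@le_trans _ _ (cabs (phi i x) ^+ 2 + cabs (phi j x) ^+ 2)%:E).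
    by rewrite /= lee_fin (le_trans (f_le x)).
  by rewrite /= lee_fin ler_norm.
split; apply: dominated => // x.
  exact: (norm_part_le false).
exact: (norm_part_le true).
Qed.

Let pairing_integral i j :
  (\int[mu]_(x in D) (complex.Re (pairing i j x))%:E = ((i == j)%:R)%:E)%E /\
  (\int[mu]_(x in D) (complex.Im (pairing i j x))%:E = 0)%E.
Proof.
have [_ /(_ i j)] := orthonormal_phi.
have [ire iim] := pairing_integrable i j.
rewrite /inner /cintegral => inner_ij.
have [reE imE] : Rintegral mu D (fun x => complex.Re (pairing i j x)) = (i == j)%:R
    /\ Rintegral mu D (fun x => complex.Im (pairing i j x)) = 0.
  move: inner_ij; rewrite -/(pairing i j) (_ : (i == j)%:R = (i == j)%:R%:C).
    by move=> [-> ->].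
  by case: (i == j).
rewrite -reE -[X in _ /\ _ = X%:E]imE /Rintegral.
by rewrite !fineK//; exact: integrable_fin_num.
Qed.

(** Every integral needed on V (norms, pairings and their imaginary parts, the
    Christoffel function) is the real part of such a sesquilinear form, and
    orthonormality leaves only its trace. *)
Lemma gram_form_integral (a : 'I_N -> 'I_N -> R[i]) :
  let f x := complex.Re (\sum_i \sum_j a i j * ((phi i x)^* * phi j x)) in
  mu.-integrable D (EFin \o f) /\
  (\int[mu]_(x in D) (f x)%:E = (complex.Re (\sum_i a i i))%:E)%E.
Proof.
pose h i j x := complex.Re (a i j) * complex.Re (pairing i j x)
              - complex.Im (a i j) * complex.Im (pairing i j x).
have Re_sum (I : Type) (s : seq I) (F : I -> R[i]) :
    complex.Re (\sum_(i <- s) F i) = \sum_(i <- s) complex.Re (F i) :> R.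
  exact: (part_sum false).
have hint i j : mu.-integrable D (EFin \o h i j).
  have [ire iim] := pairing_integrable i j.
  have := integrableB mD (integrableZl mD (complex.Re (a i j)) ire)
                         (integrableZl mD (complex.Im (a i j)) iim).
  by apply: eq_integrable => // x _; rewrite /= /h EFinB !EFinM.
have hE i j : (\int[mu]_(x in D) (h i j x)%:E
    = (complex.Re (a i j) * (i == j)%:R)%:E)%E.
  have [ire iim] := pairing_integrable i j.
  have [reE imE] := pairing_integral i j.
  transitivity (\int[mu]_(x in D)
     ((complex.Re (a i j))%:E * (complex.Re (pairing i j x))%:E
    - (complex.Im (a i j))%:E * (complex.Im (pairing i j x))%:E))%E.
    by apply: eq_integral => x _; rewrite /h EFinB !EFinM.
  rewrite integralB//; [|exact: integrableZl..].
  by rewrite !integralZl// reE imE mule0 sube0 EFinM.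
have fE x : complex.Re (\sum_i \sum_j a i j * ((phi i x)^* * phi j x)) =
    \sum_i \sum_j h i j x.
  rewrite Re_sum; apply: eq_bigr => i _; rewrite Re_sum; apply: eq_bigr => j _.
  by rewrite /h /pairing; case: (a i j) ((phi i x)^* * phi j x) => [? ?] [? ?].
move=> f.
have sumint i : mu.-integrable D (fun x => \sum_(j < N) (h i j x)%:E)%E.
  by apply: integrable_sum => // j _; exact: hint.
have fsumE x : (f x)%:E = (\sum_(i < N) \sum_(j < N) (h i j x)%:E)%E.
  by rewrite /f fE -sumEFin; apply: eq_bigr => i _; rewrite -sumEFin.
split.
  have -> : EFin \o f = (fun x => \sum_(i < N) \sum_(j < N) (h i j x)%:E)%E.
    by apply/funext => x; exact: fsumE.
  by apply: integrable_sum.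
transitivity (\int[mu]_(x in D) (\sum_(i < N) \sum_(j < N) (h i j x)%:E))%E.
  by apply: eq_integral => x _; exact: fsumE.
rewrite integral_sum// Re_sum -sumEFin; apply: eq_bigr => i _.
rewrite integral_sum//; last by move=> j; exact: hint.
under eq_bigr do rewrite hE.
rewrite (bigD1 i)//= eqxx mulr1 big1 ?adde0// => j /negbTE ji.
by rewrite eq_sym ji mulr0.
Qed.

End gram_integrals.

(** * Sampling from the density and deviation of empirical pairings *)

Section sampling.
Context d (T : measurableType d) (R : realType).
Context (mu : {measure set T -> \bar R}) (D : set T) (N : nat).
Context (phi : 'I_N -> T -> R[i]).
Hypothesis mD : measurable D.
Hypothesis orthonormal_phi : orthonormal_system mu D phi.
Local Open Scope complex_scope.

Definition lin_comb (c : 'I_N -> R[i]) (x : T) : R[i] :=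
  \sum_(n < N) c n * phi n x.

Let mphi n : cmeasurable_fun D (phi n).
Proof. by case: orthonormal_phi => /(_ n) []. Qed.

Lemma cmeasurable_lin_comb c : cmeasurable_fun D (lin_comb c).
Proof.
by apply: cmeasurable_sum => n; apply: cmeasurableM.
Qed.

Lemma measurable_christoffel : measurable_fun D (christoffel phi).
Proof.
apply: measurable_sum => n; apply: measurable_funX.
exact: measurable_cabs.
Qed.

Lemma christoffel_ge0 x : 0 <= christoffel phi x.
Proof. exact: (sqnorm_ge0 (phi^~ x)). Qed.

Lemma lin_comb_sqr_le c x :
  cabs (lin_comb c x) ^+ 2 <= sqnorm c * christoffel phi x.
Proof. exact: (cauchy_schwarz_cabs c (phi^~ x)). Qed.

Lemma pairing_lin_comb (w : R[i]) c j :
  let f x := complex.Re (w * ((lin_comb c x)^* * phi j x)) in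
  mu.-integrable D (EFin \o f) /\
  (\int[mu]_(x in D) (f x)%:E = (complex.Re (w * (c j)^*))%:E)%E.
Proof.
pose a i j' : R[i] := if j' == j then w * (c i)^* else 0.
have aE x : w * ((lin_comb c x)^* * phi j x) =
    \sum_i \sum_j' a i j' * ((phi i x)^* * phi j' x).
  rewrite /lin_comb rmorph_sum mulr_suml mulr_sumr; apply: eq_bigr => i _.
  rewrite (bigD1 j)//= big1 ?addr0; last first.
    by move=> j' /negbTE j'j; rewrite /a j'j mul0r.
  by rewrite /a eqxx rmorphM !mulrA.
move=> f; have := gram_form_integral mD orthonormal_phi a.
have -> : \sum_i a i i = w * (c j)^*.
  rewrite (bigD1 j)//= big1 ?addr0; first by rewrite /a eqxx.
  by move=> i /negbTE ij; rewrite /a ij.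
rewrite (_ : (fun x => _) = f); first by [].
by apply/funext => x; rewrite /f aE.
Qed.

Lemma integral_lin_comb_sqr c :
  (\int[mu]_(x in D) (cabs (lin_comb c x) ^+ 2)%:E = (sqnorm c)%:E)%E.
Proof.
pose a i j : R[i] := (c i)^* * c j.
have aE x : (cabs (lin_comb c x) ^+ 2)%:C =
    \sum_i \sum_j a i j * ((phi i x)^* * phi j x).
  rewrite -conjM_cabs {1}/lin_comb rmorph_sum mulr_suml.
  apply: eq_bigr => i _; rewrite /lin_comb mulr_sumr; apply: eq_bigr => j _.
  by rewrite /a rmorphM; ring.
have := (gram_form_integral mD orthonormal_phi a).2.
have -> : \sum_i a i i = (sqnorm c)%:C.
  by rewrite /sqnorm rmorph_sum; apply: eq_bigr => i _; exact: conjM_cabs.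
by under eq_integral do rewrite -aE.
Qed.

Lemma integral_christoffel :
  (\int[mu]_(x in D) (christoffel phi x)%:E = (N%:R)%:E)%E.
Proof.
pose a (i j : 'I_N) : R[i] := (i == j)%:R.
have aE x : (christoffel phi x)%:C =
    \sum_i \sum_j a i j * ((phi i x)^* * phi j x).
  rewrite /christoffel rmorph_sum; apply: eq_bigr => i _.
  rewrite (bigD1 i)//= big1 ?addr0; last first.
    by move=> j; rewrite eq_sym /a => /negbTE ->; rewrite mul0r.
  by rewrite /a eqxx mul1r conjM_cabs.
have := (gram_form_integral mD orthonormal_phi a).2.
have -> : \sum_i a i i = (N%:R : R)%:C.
  rewrite /a; under eq_bigr do rewrite eqxx.
  by rewrite sumr_const card_ord rmorph_nat.
by under eq_integral do rewrite -aE.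
Qed.

Context (tau2 : T -> R) (rho : probability T R).
Hypothesis density_tau2 : sampling_density mu D phi tau2.
Hypothesis density_rho : has_density mu D rho tau2.

Let mtau : measurable_fun D tau2. Proof. by case: density_tau2. Qed.
Let tau0 x : D x -> 0 <= tau2 x. Proof. by case: density_tau2 => _ + _ _; exact. Qed.

Lemma samples_in_domain : rho (~` D) = 0%E.
Proof.
rewrite density_rho; last exact: measurableC.
by rewrite setICl integral_set0.
Qed.

(** The quantity averaged over samples to estimate the integral of g over D.
    It vanishes outside D, and division by zero makes it vanish where tau2
    does. *)
Definition weighted (g : T -> R) : T -> R := (fun x => g x / tau2 x) \_ D.

Lemma weightedE g x : D x -> weighted g x = g x / tau2 x.
Proof. by move=> Dx; rewrite /weighted patchE mem_set. Qed.

Lemma weighted_out g x : ~ D x -> weighted g x = 0.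
Proof. by move=> Dx; rewrite /weighted patchE memNset. Qed.

Lemma measurable_weighted (g : T -> R) : measurable_fun D g ->
  measurable_fun setT (weighted g).
Proof.
move=> mg; apply: (proj1 (measurable_restrictT _ mD)).
by apply: measurable_funM => //; exact: measurable_inv_ge0.
Qed.

Lemma weighted_ge0 g x : (forall y, D y -> 0 <= g y) -> 0 <= weighted g x.
Proof.
move=> g0; have [Dx|Dx] := pselect (D x).
  by rewrite weightedE// divr_ge0 ?g0 ?tau0.
by rewrite weighted_out.
Qed.

(** Where tau2 vanishes the coverage condition forces k = 0 almost everywhere,
    hence g = 0, so nothing is lost by the division. *)
Lemma integral_weighted (g : T -> R) : measurable_fun D g ->
  (forall x, D x -> christoffel phi x = 0 -> g x = 0) ->
  (\int[rho]_x (weighted g x)%:E = \int[mu]_(x in D) (g x)%:E)%E.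
Proof.
move=> mg g0; pose h := tau2 \_ D.
have mh : measurable_fun setT h by apply: (proj1 (measurable_restrictT _ mD)).
have h0 x : 0 <= h x.
  by rewrite /h patchE; case: ifPn => //; rewrite inE => /tau0.
have rhoE A : measurable A -> rho A = (\int[mu]_(x in idfun @^-1` A) (h x)%:E)%E.
  move=> mA; rewrite density_rho// integral_mkcondr.
  by apply: eq_integral => x _; rewrite (restrict_EFin tau2 D).
have mw := measurable_weighted mg.
rewrite (change_of_variables mh h0 (@measurable_id _ T setT) rhoE)//;
  last exact/measurable_EFinP.
rewrite [RHS]integral_mkcond.
have coverage : {ae mu, forall x, D x -> tau2 x = 0 -> christoffel phi x = 0}.
  by case: density_tau2.
apply: ae_eq_integral => //.
- by apply: emeasurable_funM; apply/measurable_EFinP.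
- rewrite (restrict_EFin g D); apply/measurable_EFinP.
  exact: (proj1 (measurable_restrictT _ mD)).
apply: filterS coverage => x cov _ /=.
rewrite -EFinM patchE; case: ifPn => [|xD]; last first.
  by rewrite weighted_out ?mul0r// => Dx; move: xD; rewrite mem_set.
rewrite inE => Dx; rewrite weightedE// /h patchE mem_set//.
have [t0|t0] := eqVneq (tau2 x) 0; last by rewrite divfK.
by rewrite t0 mulr0 (g0 x Dx (cov Dx t0)).
Qed.

Lemma integrable_weighted (g : T -> R) :
  (forall x, D x -> christoffel phi x = 0 -> g x = 0) ->
  mu.-integrable D (EFin \o g) -> rho.-integrable setT (EFin \o weighted g).
Proof.
move=> g0 /integrableP[mg fin].
have {}mg : measurable_fun D g by exact/measurable_EFinP.
apply/integrableP; split.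
  by apply/measurable_EFinP; exact: measurable_weighted.
apply: le_lt_trans fin; rewrite le_eqVlt; apply/orP; left; apply/eqP.
have -> : (\int[mu]_(x in D) `|(EFin \o g) x| = \int[mu]_(x in D) (`|g x|)%:E)%E.
  by apply: eq_integral.
rewrite -integral_weighted; first last.
- by move=> x Dx kx; rewrite g0// normr0.
- exact: measurableT_comp.
apply: eq_integral => x _ /=; congr EFin.
have [Dx|Dx] := pselect (D x); last by rewrite !weighted_out// normr0.
by rewrite !weightedE// normrM normfV (ger0_norm (tau0 Dx)).
Qed.

Context (Q : R).
Hypothesis Q0 : 0 <= Q.
Hypothesis kQ : {ae rho, forall x, D x -> christoffel phi x <= Q * tau2 x}.

(** The mean of k / tau2 under rho is N. *)
Lemma dim_le_sup : N%:R <= Q.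
Proof.
have := integral_weighted measurable_christoffel (fun _ _ => id).
rewrite integral_christoffel => kN; rewrite -lee_fin -kN.
apply: (@le_trans _ _ (\int[rho]_x Q%:E)%E).
  apply: ae_ge0_le_integral => //.
  - by move=> x _; rewrite lee_fin weighted_ge0// => y _; exact: christoffel_ge0.
  - apply/measurable_EFinP; apply: measurable_weighted.
    exact: measurable_christoffel.
  apply: filterS kQ => x kx _; rewrite lee_fin.
  have [Dx|Dx] := pselect (D x); last by rewrite weighted_out.
  rewrite weightedE//; have [t0|t0] := eqVneq (tau2 x) 0.
    by rewrite t0 invr0 mulr0.
  by rewrite ler_pdivrMr ?lt0r ?t0 ?tau0// kx.
by rewrite integral_cst// [X in (_ * X)%E]probability_setT mule1.
Qed.

(** One real coordinate of a sample of the row l G, with conj c in the role of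
    l. *)
Definition sample_part c (p : bool * 'I_N) : T -> R :=
  weighted (fun x => part p.1 ((lin_comb c x)^* * phi p.2 x)).

Let phi_eq0 x j : christoffel phi x = 0 -> phi j x = 0.
Proof. by move=> /(@sqnorm_eq0 _ _ (phi^~ x)). Qed.

Lemma sample_part_integral c p :
  rho.-integrable setT (EFin \o sample_part c p) /\
  (\int[rho]_x (sample_part c p x)%:E = (part p.1 (c p.2)^*)%:E)%E.
Proof.
have [] := pairing_lin_comb (if p.1 then - 'i else 1) c p.2.
set f := fun x => complex.Re _ => fint fE.
have fpart : (fun x => part p.1 ((lin_comb c x)^* * phi p.2 x)) = f.
  by apply/funext => x; rewrite partE.
have f0 x : D x -> christoffel phi x = 0 -> f x = 0.
  by move=> Dx /(phi_eq0 p.2) phi0; rewrite /f phi0 !mulr0.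
have mf : measurable_fun D f by apply/measurable_EFinP; case/integrableP: fint.
rewrite /sample_part fpart; split; first exact: integrable_weighted.
by rewrite integral_weighted// fE partE.
Qed.

Let summand_le c j x :
  cabs ((lin_comb c x)^* * phi j x) <= Num.sqrt (sqnorm c) * christoffel phi x.
Proof.
rewrite -(ler_pXn2r (n := 2))// ?nnegrE ?cabs_ge0//; last first.
  by rewrite mulr_ge0 ?sqrtr_ge0 ?christoffel_ge0.
rewrite cabsM cabs_conj !exprMn sqr_sqrtr ?sqnorm_ge0// [leRHS]mulrA.
apply: ler_pM; rewrite ?sqr_ge0 ?lin_comb_sqr_le//.
exact: (cabs_sqr_le_sqnorm (phi^~ x)).
Qed.

Lemma sample_part_bounded c p :
  {ae rho, forall x, `|sample_part c p x| <= Num.sqrt (sqnorm c) * Q}.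
Proof.
apply: filterS kQ => x kx; have [Dx|Dx] := pselect (D x); last first.
  by rewrite /sample_part weighted_out// normr0 mulr_ge0 ?sqrtr_ge0.
rewrite /sample_part weightedE// normrM normfV (ger0_norm (tau0 Dx)).
have [t0|t0] := eqVneq (tau2 x) 0.
  by rewrite t0 invr0 mulr0 mulr_ge0 ?sqrtr_ge0.
rewrite ler_pdivrMr ?lt0r ?t0 ?tau0//.
apply: le_trans (norm_part_le _ _) _; apply: le_trans (summand_le _ _ _) _.
by rewrite -mulrA ler_wpM2l ?sqrtr_ge0 ?kx.
Qed.

Let sum_bool_pair (F : bool * 'I_N -> R) :
  \sum_p F p = \sum_j (F (true, j) + F (false, j)).
Proof.
rewrite (eq_bigr (fun p => F (p.1, p.2))) => [|[]//].
by rewrite -(pair_bigA _ (fun b j => F (b, j))) /= big_bool -big_split.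
Qed.

(** The squares of all coordinates of one sample add up to
    (|u| / tau2)^2 k <= Q |u|^2 / tau2, where u is the combination with
    coefficients c. Thus the total second moment is Q |c|^2, without a factor
    N. *)
Lemma sample_part_second_moments c : exists v : bool * 'I_N -> R,
  [/\ forall p, (\int[rho]_x (sample_part c p x ^+ 2)%:E = (v p)%:E)%E,
      forall p, 0 <= v p & \sum_p v p <= Q * sqnorm c].
Proof.
have mH p : measurable_fun setT (fun x => sample_part c p x ^+ 2).
  apply: measurable_funX; apply/measurable_EFinP.
  by case/integrableP: (sample_part_integral c p).1.
have intge0 p : (0 <= \int[rho]_x (sample_part c p x ^+ 2)%:E)%E.
  by apply: integral_ge0 => x _; rewrite lee_fin sqr_ge0.
have mu2 : measurable_fun D (fun x => cabs (lin_comb c x) ^+ 2).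
  by apply: measurable_funX; apply: measurable_cabs; exact: cmeasurable_lin_comb.
have sum_le : (\sum_p \int[rho]_x (sample_part c p x ^+ 2)%:E
    <= (Q * sqnorm c)%:E)%E.
  have -> : ((Q * sqnorm c)%:E =
      \int[rho]_x (Q%:E * (weighted (fun x => cabs (lin_comb c x) ^+ 2) x)%:E))%E.
    rewrite EFin_integralZl//.
    - rewrite integral_weighted// ?integral_lin_comb_sqr// => x Dx kx.
      apply/eqP; rewrite eq_le sqr_ge0 andbT.
      by rewrite (le_trans (lin_comb_sqr_le _ _))// kx mulr0.
    - exact: measurable_weighted.
    - by move=> x; apply: weighted_ge0 => y _; exact: sqr_ge0.
  rewrite -ge0_integral_sum//; last 2 first.
  - by move=> p; apply/measurable_EFinP.
  - by move=> p x _; rewrite lee_fin sqr_ge0.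
  apply: ae_ge0_le_integral => //.
  - by move=> x _; apply: sume_ge0 => p _; rewrite lee_fin sqr_ge0.
  - by apply: emeasurable_sum => p; apply/measurable_EFinP.
  - move=> x _; rewrite -EFinM lee_fin mulr_ge0//.
    by apply: weighted_ge0 => y _; exact: sqr_ge0.
  - by apply/measurable_EFinP/measurable_funM => //; exact: measurable_weighted.
  apply: filterS kQ => x kx _; rewrite -EFinM sumEFin lee_fin.
  have [Dx|Dx] := pselect (D x); last first.
    rewrite weighted_out// mulr0 big1// => p _.
    by rewrite /sample_part weighted_out// expr0n.
  rewrite weightedE//.
  rewrite sum_bool_pair.
  have [t0|t0] := eqVneq (tau2 x) 0.
    rewrite t0 invr0 !mulr0 big1// => j _.
    by rewrite /sample_part !weightedE// t0 invr0 !mulr0 expr0n addr0.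
  have tpos : 0 < tau2 x by rewrite lt0r t0 tau0.
  have -> : \sum_j (sample_part c (true, j) x ^+ 2
                   + sample_part c (false, j) x ^+ 2) =
      cabs (lin_comb c x) ^+ 2 * christoffel phi x / tau2 x ^+ 2.
    rewrite /christoffel mulr_sumr mulr_suml; apply: eq_bigr => j _.
    rewrite /sample_part !weightedE//= !exprMn exprVn -mulrDl -cabs_sqr_parts.
    by rewrite cabsM cabs_conj exprMn.
  move: (kx Dx) (sqr_ge0 (cabs (lin_comb c x))); move: (_ ^+ 2) => A kxD A0.
  rewrite ler_pdivrMr ?exprn_gt0//.
  have -> : Q * (A / tau2 x) * tau2 x ^+ 2 = A * (Q * tau2 x) by field.
  by rewrite ler_wpM2l.
exists (fun p => fine (\int[rho]_x (sample_part c p x ^+ 2)%:E)%E).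
have vE p : (\int[rho]_x (sample_part c p x ^+ 2)%:E =
    (fine (\int[rho]_x (sample_part c p x ^+ 2)%:E))%:E)%E.
  rewrite fineK// ge0_fin_numE//; apply: le_lt_trans (ltry (Q * sqnorm c)).
  apply: le_trans sum_le; rewrite (bigD1 p)//= leeDl//.
  exact: sume_ge0.
split => // [p|]; first exact: fine_ge0.
by rewrite -lee_fin -sumEFin; under eq_bigr do rewrite -vE.
Qed.

(** Each coordinate gets a share of the squared error proportional to its
    second moment. To keep the exponential parameter l small compared to the
    bound |c| Q on the coordinates, the second moments are first raised by
    1 / (2 N) of one fifth of the bound Q |c|^2 on their sum. Then the shares
    add up to the error allowed when t^2 = 5 al V / (6 Q), and
    t^2 / (4 V) = 5 al / (24 Q) is the same exponent for all coordinates. *)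
Lemma empirical_pairing_deviation dO (Omega : measurableType dO)
    (P : probability Omega R) M (x : 'I_M -> {mfun Omega >-> T})
    (c : 'I_N -> R[i]) (al : R) :
  iid_samples P rho x -> (0 < M)%N -> (0 < N)%N -> 0 < sqnorm c -> 0 < al ->
  al <= (20 * N%:R)^-1 ->
  fails_with_prob_le P (4 * N%:R * expR (- (5 / 24 * (M%:R * al) / Q)))
    (fun w => (forall m, D (x m w)) ->
       \sum_(j < N) cabs (M%:R^-1 * \sum_(m < M)
           (lin_comb c (x m w))^* * phi j (x m w) / (tau2 (x m w))%:C
         - (c j)^*) ^+ 2 <= al * sqnorm c).
Proof.
move=> iid_x M0 N0 c0 al0 al_le.
have [v [vE v0 v_le]] := sample_part_second_moments c.
have N0' : 0 < (N%:R : R) by rewrite ltr0n.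
have M0' : 0 < (M%:R : R) by rewrite ltr0n.
have Qpos : 0 < Q by exact: lt_le_trans dim_le_sup.
pose floor := Q * sqnorm c / (10 * N%:R).
have floor0 : 0 < floor by rewrite divr_gt0 ?mulr_gt0.
pose V p := v p + floor.
have V0 p : 0 < V p by rewrite ltr_wpDl.
pose t p := Num.sqrt (5 * al * V p / (6 * Q)).
have t2 p : t p ^+ 2 = 5 * al * V p / (6 * Q).
  by rewrite sqr_sqrtr// divr_ge0 ?mulr_ge0// ltW.
have t0 p : 0 < t p by rewrite sqrtr_gt0 divr_gt0 ?mulr_gt0.
have coordinate p : fails_with_prob_le P
    (2 * expR (- (5 / 24 * (M%:R * al) / Q)))
    (fun w => `|\sum_(m < M) sample_part c p (x m w)
               - M%:R * part p.1 (c p.2)^*| < M%:R * t p).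
  have [Hint HE] := sample_part_integral c p.
  have Hsq : (\int[rho]_y (sample_part c p y ^+ 2)%:E <= (v p)%:E)%E by rewrite vE.
  pose l := t p / (2 * V p).
  have l0 : 0 < l by rewrite divr_gt0 ?mulr_gt0.
  have lB : l * (Num.sqrt (sqnorm c) * Q) <= 3^-1.
    have lB0 : 0 <= l * (Num.sqrt (sqnorm c) * Q).
      by apply: mulr_ge0; [exact: ltW|exact: mulr_ge0 (sqrtr_ge0 _) Q0].
    rewrite -(ler_pXn2r (n := 2))// ?nnegrE ?invr_ge0//.
    rewrite !exprMn t2 sqr_sqrtr ?sqnorm_ge0//.
    have -> : 5 * al * V p / (6 * Q) * (2 * V p)^-1 ^+ 2 * (sqnorm c * Q ^+ 2) =
       5 * al * sqnorm c * Q / 24 / V p by field; rewrite !gt_eqF.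
    rewrite ler_pdivrMr//.
    apply: (@le_trans _ _ (3^-1 ^+ 2 * floor)); last first.
      by rewrite ler_wpM2l ?sqr_ge0// lerDr.
    have alN : al * (20 * N%:R) <= 1 by rewrite -ler_pdivlMr ?mulr_gt0// mul1r.
    have -> : 3^-1 ^+ 2 * floor =
       Q * sqnorm c / (90 * N%:R) by rewrite /floor; field; rewrite gt_eqF.
    rewrite ler_pdivlMr ?mulr_gt0//.
    have -> : 5 * al * sqnorm c * Q / 24 * (90 * N%:R) =
       Q * sqnorm c * (al * (20 * N%:R)) * (450 / 480) by field.
    have Qc : 0 < Q * sqnorm c by rewrite mulr_gt0.
    have : Q * sqnorm c * (al * (20 * N%:R)) <= Q * sqnorm c.
      by rewrite -[leRHS]mulr1 ler_pM2l.
    lra.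
  apply: fails_with_prob_leW (second_moment_deviation (t p) iid_x Hint HE
    Hsq (sample_part_bounded c p) l0 lB) => //.
  rewrite ler_pM2l// ler_expR.
  have -> : - (5 / 24 * (M%:R * al) / Q) = M%:R * (l ^+ 2 * V p - l * t p).
    have -> : l ^+ 2 * V p - l * t p = - (t p ^+ 2) / (4 * V p).
      by rewrite /l; field; rewrite gt_eqF.
    by rewrite t2; field; rewrite !gt_eqF.
  by rewrite ler_pM2l// lerD2r ler_wpM2l ?sqr_ge0// lerDl ltW.
apply: fails_with_prob_leW (fails_with_prob_le_all coordinate).
  rewrite card_prod card_bool card_ord natrM le_eqVlt.
  by apply/orP; left; apply/eqP; ring.
move=> w wt wD.
have coordE b j : part b (M%:R^-1 * \sum_(m < M)
      (lin_comb c (x m w))^* * phi j (x m w) / (tau2 (x m w))%:C - (c j)^*) =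
    (\sum_(m < M) sample_part c (b, j) (x m w) - M%:R * part b (c j)^*) / M%:R.
  rewrite partD partN (_ : M%:R^-1 = (M%:R^-1 : R)%:C); last first.
    by rewrite fmorphV rmorph_nat.
  rewrite partZ part_sum mulrBl [_ / M%:R]mulrC [M%:R * _]mulrC mulfK ?gt_eqF//.
  congr (_ * _ - _); apply: eq_bigr => m _.
  rewrite /sample_part weightedE//= -fmorphV mulrC partZ mulrC.
  by [].
have coord_le b j : part b (M%:R^-1 * \sum_(m < M)
      (lin_comb c (x m w))^* * phi j (x m w) / (tau2 (x m w))%:C - (c j)^*) ^+ 2
    <= t (b, j) ^+ 2.
  rewrite coordE -real_normK ?num_real//.
  rewrite lerXn2r ?nnegrE ?normr_ge0 ?(ltW (t0 _))//.
  rewrite normrM normfV (ger0_norm (ltW M0')) ler_pdivrMr// [leRHS]mulrC.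
  exact: ltW (wt (b, j)).
apply: (@le_trans _ _ (\sum_p t p ^+ 2)).
  rewrite sum_bool_pair; apply: ler_sum => j _.
  by rewrite cabs_sqr_parts lerD.
under eq_bigr do rewrite t2.
have -> : \sum_p 5 * al * V p / (6 * Q) =
    5 * al / (6 * Q) * (\sum_p v p + 2 * N%:R * floor).
  rewrite /V [in RHS](_ : 2 * N%:R * floor = \sum_(p : bool * 'I_N) floor).
    rewrite -big_split mulr_sumr; apply: eq_bigr => p _.
    by rewrite mulrAC.
  by rewrite sumr_const card_prod card_bool card_ord -[RHS]mulr_natl natrM.
apply: (@le_trans _ _ (5 * al / (6 * Q) * (Q * sqnorm c + 2 * N%:R * floor))).
  by rewrite ler_wpM2l ?divr_ge0 ?mulr_ge0 ?(ltW al0)// lerD2r.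
rewrite /floor le_eqVlt; apply/orP; left; apply/eqP; field.
by rewrite !gt_eqF.
Qed.

End sampling.

(** * The functional, its norm and stability of the rule *)

Section functional.
Context d (T : measurableType d) (R : realType) (N : nat).
Context (phi : 'I_N -> T -> R[i]).
Context (Lf : (T -> R[i]) -> R[i]).
Hypothesis linear_Lf : linear_functional_on (lin_span phi) Lf.
Local Open Scope complex_scope.

Let ell n : R[i] := Lf (phi n).

Lemma functional_lin_comb c :
  Lf (lin_comb phi c) = \sum_(n < N) c n * Lf (phi n).
Proof.
have span0 : lin_span phi (fun=> 0).
  exists (fun=> 0); apply/funext => x.
  by rewrite big1// => n _; rewrite mul0r.
have spanD a u v : lin_span phi u -> lin_span phi v ->
    lin_span phi (fun x => a * u x + v x).
  move=> [cu ->] [cv ->]; exists (fun n => a * cu n + cv n).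
  apply/funext => x; rewrite mulr_sumr -big_split; apply: eq_bigr => n _ /=.
  by rewrite mulrDl mulrA.
have spanphi n : lin_span phi (phi n).
  exists (fun i => (i == n)%:R); apply/funext => x.
  rewrite (bigD1 n)//= big1 ?addr0 ?eqxx ?mul1r// => i /negbTE ->.
  by rewrite mul0r.
have Lf0 : Lf (fun=> 0) = 0.
  have := linear_Lf (-1) span0 span0.
  rewrite (_ : (fun x => _) = (fun=> 0)); last first.
    by apply/funext => x; rewrite mulr0 addr0.
  by move=> ->; rewrite mulN1r addNr.
suff [] : lin_span phi (fun x => \sum_(n < N) c n * phi n x) /\
    Lf (fun x => \sum_(n < N) c n * phi n x) = \sum_(n < N) c n * Lf (phi n) by [].
elim: (index_enum _) => [|n s [IHspan IHs]].
  rewrite big_nil (_ : (fun x => _) = (fun=> 0)) ?Lf0//.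
  by apply/funext => x; rewrite big_nil.
rewrite big_cons -IHs -linear_Lf//.
rewrite (_ : (fun x => _) =
  (fun x => c n * phi n x + \sum_(n <- s) c n * phi n x)).
  by split=> //; exact: spanD.
by apply/funext => x; rewrite big_cons.
Qed.

Lemma riesz_representerE :
  riesz_representer phi Lf = lin_comb phi (fun n => (Lf (phi n))^*).
Proof. by []. Qed.

Lemma functional_sqnorm_gt0 :
  (exists v, lin_span phi v /\ Lf v != 0) -> 0 < sqnorm (fun n => Lf (phi n)).
Proof.
move=> [v [[c ->]]]; apply: contraNT; rewrite -leNgt => l_le0.
have l0 : sqnorm (fun n => Lf (phi n)) = 0.
  by apply/eqP; rewrite eq_le l_le0 sqnorm_ge0.
apply/eqP; rewrite (functional_lin_comb c) big1// => n _.
by rewrite (sqnorm_eq0 l0) mulr0.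
Qed.

Lemma sqnorm_conj n (c : 'I_n -> R[i]) : sqnorm (fun i => (c i)^*) = sqnorm c.
Proof. by apply: eq_bigr => i _; rewrite cabs_conj. Qed.

End functional.

Section dual_norm.
Context d (T : measurableType d) (R : realType).
Context (mu : {measure set T -> \bar R}) (D : set T) (N : nat).
Context (phi : 'I_N -> T -> R[i]) (Lf : (T -> R[i]) -> R[i]).
Hypothesis mD : measurable D.
Hypothesis orthonormal_phi : orthonormal_system mu D phi.
Hypothesis linear_Lf : linear_functional_on (lin_span phi) Lf.
Hypothesis Lf_neq0 : exists v, lin_span phi v /\ Lf v != 0.
Local Open Scope complex_scope.

(** The functional takes the value |l| at L / |l|, a vector of norm 1. The
    supremum is finite by the Cauchy-Schwarz inequality. *)
Lemma le_dual_norm :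
  Num.sqrt (sqnorm (fun n => Lf (phi n))) <= dual_norm mu D (lin_span phi) Lf.
Proof.
set ell := fun n => Lf (phi n); set r := Num.sqrt (sqnorm ell).
have r2 : r ^+ 2 = sqnorm ell by rewrite sqr_sqrtr ?sqnorm_ge0.
have r0 : 0 < r by rewrite sqrtr_gt0; exact: functional_sqnorm_gt0 Lf_neq0.
have normE c : L2norm mu D (lin_comb phi c) = Num.sqrt (sqnorm c).
  by rewrite /L2norm /Rintegral integral_lin_comb_sqr.
apply: ub_le_sup.
  exists r => _ [v [[c ->] vn] <-].
  rewrite -(ler_pXn2r (n := 2))// ?nnegrE ?cabs_ge0 ?(ltW r0)//.
  rewrite (functional_lin_comb linear_Lf c).
  apply: le_trans (cauchy_schwarz_cabs c ell) _; rewrite r2.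
  rewrite -[leRHS]mul1r ler_wpM2r ?sqnorm_ge0//.
  have := vn; rewrite (normE c) -[leRHS]sqrtr1 ler_sqrt//.
pose c n := (r^-1)%:C * (ell n)^*.
exists (lin_comb phi c).
  split; first by exists c.
  rewrite normE -[leRHS]sqrtr1 ler_wsqrtr//.
  rewrite /sqnorm (eq_bigr (fun n => r ^- 2 * cabs (ell n) ^+ 2)); last first.
    move=> n _; rewrite /c cabsM cabs_conj exprMn cabs_real ?exprVn//.
    by rewrite invr_ge0 ltW.
  by rewrite -mulr_sumr -/(sqnorm ell) -r2 mulVf// expf_neq0// gt_eqF.
rewrite functional_lin_comb//.
rewrite (eq_bigr (fun n => (r^-1 * cabs (ell n) ^+ 2)%:C)); last first.
  by move=> n _; rewrite /c -mulrA conjM_cabs -rmorphM.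
rewrite -rmorph_sum -mulr_sumr -/(sqnorm ell) -r2 expr2 mulKf ?gt_eqF//.
by apply: cabs_real; exact: ltW.
Qed.

End dual_norm.

Section quadrature_stability.
Context d (T : measurableType d) (R : realType) (N M : nat).
Context (phi : 'I_N -> T -> R[i]) (tau2 : T -> R).
Context (Lf : (T -> R[i]) -> R[i]) (pts : 'I_M -> T) (D : set T) (J a sg : R).
Local Open Scope complex_scope.

Let ell : 'rV[R[i]]_N := \row_(n < N) Lf (phi n).
Let G : 'M[R[i]]_N := gram phi tau2 pts.
Let k := christoffel phi.
Let L := riesz_representer phi Lf.

(** Identifies the error of the row l G with the empirical pairings controlled
    by [empirical_pairing_deviation]. *)
Lemma sqnorm_gramB c (l : 'rV[R[i]]_N) : (forall n, l ord0 n = (c n)^*) ->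
  sqnorm ((l *m G - l) ord0) =
  \sum_(j < N) cabs (M%:R^-1 * \sum_(m < M)
    (lin_comb phi c (pts m))^* * phi j (pts m) / (tau2 (pts m))%:C
    - (c j)^*) ^+ 2.
Proof.
move=> lE; apply: eq_bigr => j _; rewrite !mxE lE; congr (cabs (_ - _) ^+ 2).
under eq_bigr => i _ do rewrite lE mxE mulrCA.
rewrite -mulr_sumr; congr (_ * _).
under eq_bigr do rewrite mulr_sumr.
rewrite exchange_big; apply: eq_bigr => m _ /=.
rewrite /lin_comb rmorph_sum !mulr_suml; apply: eq_bigr => i _.
by rewrite rmorphM !mulrA.
Qed.

Hypothesis M_gt0 : (0 < M)%N.
Hypothesis linear_Lf : linear_functional_on (lin_span phi) Lf.
Hypothesis G1 : \sum_(j < N) sqnorm ((G - 1%:M) ^~ j) <= 10^-1 ^+ 2.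
Hypothesis ellG : sqnorm ((ell *m G - ell) ord0) <= a * sqnorm (ell ord0).
Hypotheses (a0 : 0 <= a) (sg0 : 0 <= sg).
Hypothesis aJ : a * J <= (9 / 10) ^+ 2 * sg ^+ 2.
Hypothesis ptsD : forall m, D (pts m).
Hypothesis tau2_ge0 : forall x, D x -> 0 <= tau2 x.
Hypothesis angle : forall m,
  sqnorm (ell ord0) * k (pts m) <= J * cabs (L (pts m)) ^+ 2.

Let tenth : 0 < (10^-1 : R) < 1.
Proof. by apply/andP; split; lra. Qed.

Lemma gram_unit : G \in unitmx.
Proof. exact: unitmx_perturbation tenth G1. Qed.

Let r := ell *m invmx G.

Let ls_weightE m : ls_weight phi tau2 Lf pts m =
  (M%:R * (tau2 (pts m))%:C)^-1 * \sum_(i < N) r ord0 i * (phi i (pts m))^*.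
Proof.
by rewrite /ls_weight mxE; congr (_ * _); apply: eq_bigr => i _; rewrite [X in _ * X]mxE.
Qed.

Lemma ls_rule_exact : exact_on phi tau2 Lf pts (lin_span phi).
Proof.
have rG n : \sum_(m < M) ls_weight phi tau2 Lf pts m * phi n (pts m) = Lf (phi n).
  have : (r *m G) ord0 n = Lf (phi n) by rewrite mulmxKV ?gram_unit// mxE.
  move=> <-; rewrite mxE.
  under [RHS]eq_bigr do rewrite [X in _ * X]mxE !mulr_sumr.
  rewrite exchange_big; apply: eq_bigr => m _.
  rewrite ls_weightE mulrAC mulr_sumr; apply: eq_bigr => i _.
  by rewrite invfM; ring.
move=> v [c ->]; rewrite (functional_lin_comb linear_Lf c) /ls_rule.
under eq_bigr do rewrite mulr_sumr.
rewrite exchange_big; apply: eq_bigr => n _; rewrite -rG mulr_sumr.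
by apply: eq_bigr => m _; rewrite mulrCA.
Qed.

(** The error of the weight is |(r - l) conj phi| with
    |r - l|^2 <= a |l|^2 / (9/10)^2, and the angle condition compares
    |l| sqrt k with sqrt J |L|. *)
Lemma ls_weight_le m :
  cabs (ls_weight phi tau2 Lf pts m) <=
  (1 + sg) * (cabs (L (pts m)) / (M%:R * tau2 (pts m))).
Proof.
set y := pts m.
have conjL : \sum_(i < N) ell ord0 i * (phi i y)^* = (L y)^*.
  rewrite /L /riesz_representer rmorph_sum; apply: eq_bigr => i _.
  by rewrite mxE [RHS]rmorphM /= conjcK.
have dr : sqnorm ((r - ell) ord0) <= a * sqnorm (ell ord0) / (9 / 10) ^+ 2.
  apply: le_trans (inverse_perturbation tenth G1 ell) _.
  have -> : (1 - 10^-1 : R) = 9 / 10 by field.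
  by rewrite ler_wpM2r// invr_ge0 sqr_ge0.
have diff_le : cabs (\sum_(i < N) (r - ell) ord0 i * (phi i y)^*) <= sg * cabs (L y).
  rewrite -(ler_pXn2r (n := 2))// ?nnegrE ?cabs_ge0 ?mulr_ge0 ?cabs_ge0//.
  apply: le_trans (cauchy_schwarz_cabs _ _) _.
  rewrite (sqnorm_conj (phi^~ y)).
  apply: (@le_trans _ _ (a * sqnorm (ell ord0) / (9 / 10) ^+ 2 * k y)).
    by rewrite ler_wpM2r// christoffel_ge0.
  have -> : a * sqnorm (ell ord0) / (9 / 10) ^+ 2 * k y =
     a / (9 / 10) ^+ 2 * (sqnorm (ell ord0) * k y) by field.
  apply: (@le_trans _ _ (a / (9 / 10) ^+ 2 * (J * cabs (L y) ^+ 2))).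
    by rewrite ler_wpM2l ?angle// divr_ge0 ?sqr_ge0.
  rewrite [leRHS]exprMn [leLHS]mulrA ler_wpM2r ?sqr_ge0//.
  have q0 : 0 < (9 / 10) ^+ 2 :> R by rewrite exprn_gt0// divr_gt0.
  by rewrite mulrAC ler_pdivrMr// [leRHS]mulrC.
have M0 : 0 <= M%:R * tau2 y by apply: mulr_ge0 => //; exact: tau2_ge0 (ptsD m).
rewrite ls_weightE cabsM (_ : M%:R * (tau2 y)%:C = (M%:R * tau2 y)%:C).
  rewrite cabs_real_inv// mulrA mulrC ler_wpM2r ?invr_ge0//.
  have -> : \sum_(i < N) r ord0 i * (phi i y)^* =
      (L y)^* + \sum_(i < N) (r - ell) ord0 i * (phi i y)^*.
    rewrite -[X in _ = X + _]conjL -big_split; apply: eq_bigr => i _ /=.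
    have -> : (r - ell) ord0 i = r ord0 i - ell ord0 i by rewrite !mxE.
    by rewrite -mulrDl addrCA subrr addr0.
  apply: le_trans (le_cabsD _ _) _; rewrite cabs_conj.
  by rewrite mulrDl mul1r lerD2l.
by rewrite rmorphM rmorph_nat.
Qed.

(** On the unit ball |u| <= 1 / W at the samples. *)
Lemma cond_number_ls_rule_le (W : T -> R) : (forall x, D x -> 0 < W x) ->
  (cond_number D W (ls_rule phi tau2 Lf pts) <=
   ((1 + sg) * (M%:R^-1 * \sum_(m < M) Kfun phi tau2 W Lf (pts m)))%:E)%E.
Proof.
move=> W0; apply: ub_ereal_sup => _ [u [_ u1] <-]; rewrite lee_fin.
apply: le_trans (le_cabs_sum _ _) _.
rewrite mulr_sumr mulr_sumr; apply: ler_sum => m _; rewrite cabsM.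
have Wm := W0 _ (ptsD m).
have u_le : cabs (u (pts m)) <= (W (pts m))^-1.
  rewrite -[leRHS]mul1r ler_pdivlMr// mulrC -lee_fin.
  apply: le_trans u1; apply: ereal_sup_ubound.
  by exists (pts m).
apply: (@le_trans _ _ ((1 + sg) * (cabs (L (pts m)) / (M%:R * tau2 (pts m)))
    * (W (pts m))^-1)).
  by apply: ler_pM; rewrite ?cabs_ge0 ?ls_weight_le.
rewrite /Kfun; case: eqP => [->|/eqP t0].
  by rewrite !mulr0 invr0 !mulr0 mul0r.
rewrite -/L le_eqVlt; apply/orP; left; apply/eqP; field.
by rewrite t0 gt_eqF//= pnatr_eq0 -lt0n.
Qed.

End quadrature_stability.

(** * Concentration of the weighted average *)

Section reference_weight.
Context d (T : measurableType d) (R : realType).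
Context (mu : {measure set T -> \bar R}) (D : set T) (N : nat).
Context (phi : 'I_N -> T -> R[i]) (tau2 : T -> R) (rho : probability T R).
Context (Lf : (T -> R[i]) -> R[i]) (W : T -> R).
Hypothesis mD : measurable D.
Hypothesis orthonormal_phi : orthonormal_system mu D phi.
Hypothesis density_tau2 : sampling_density mu D phi tau2.
Hypothesis density_rho : has_density mu D rho tau2.
Hypothesis linear_Lf : linear_functional_on (lin_span phi) Lf.
Hypothesis Lf_neq0 : exists v, lin_span phi v /\ Lf v != 0.
Hypothesis weight_W : approximation_weight D W.

Let L := riesz_representer phi Lf.
Let g x := cabs (L x) / W x.
Let K := Kfun phi tau2 W Lf.
Let mtau : measurable_fun D tau2. Proof. by case: density_tau2. Qed.
Let tau0 x : D x -> 0 <= tau2 x. Proof. by case: density_tau2 => _ + _ _; exact. Qed.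
Let mW : measurable_fun D W. Proof. by case: weight_W. Qed.
Let W0 x : D x -> 0 < W x. Proof. by case: weight_W => _; exact. Qed.

Lemma cmeasurable_riesz_representer : cmeasurable_fun D L.
Proof. exact: cmeasurable_lin_comb orthonormal_phi _. Qed.

Lemma riesz_representer_eq0 x : christoffel phi x = 0 -> L x = 0.
Proof.
move=> kx; apply/eqP; rewrite -cabs_eq0 -sqrf_eq0 eq_le sqr_ge0 andbT.
by rewrite (le_trans (lin_comb_sqr_le phi _ _))// kx mulr0.
Qed.

Let mg : measurable_fun D g.
Proof.
apply: measurable_funM; first exact: measurable_cabs cmeasurable_riesz_representer.
by apply: measurable_inv_ge0 => // x /W0/ltW.
Qed.

Let g0 x : D x -> 0 <= g x.
Proof. by move=> Dx; rewrite divr_ge0 ?cabs_ge0// ltW// W0. Qed.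

Lemma Kfun_weighted x : D x -> weighted D tau2 g x = K x.
Proof.
move=> Dx; rewrite weightedE// /K /Kfun -/L /g.
have [->|t0] := eqVneq (tau2 x) 0; first by rewrite invr0 mulr0.
by rewrite invfM mulrAC mulrA.
Qed.

Let mK : measurable_fun setT (weighted D tau2 g).
Proof. exact: (measurable_weighted mD density_tau2). Qed.

Let K0 x : 0 <= weighted D tau2 g x.
Proof. exact: weighted_ge0 density_tau2 _ _ g0. Qed.

Lemma integral_Kfun :
  (\int[rho]_x (weighted D tau2 g x)%:E = \int[mu]_(x in D) (g x)%:E)%E.
Proof.
apply: (integral_weighted mD density_tau2 density_rho mg) => x Dx kx.
by rewrite /g riesz_representer_eq0// cabs0 mul0r.
Qed.

Lemma integral_exp_Kfun (c : R) :
  (\int[rho]_(x in D) (expR (K x / c))%:E)%E =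
  (\int[rho]_x (expR (weighted D tau2 g x / c))%:E)%E.
Proof.
have me : measurable_fun setT (fun x => expR (weighted D tau2 g x / c)).
  by apply: measurableT_comp => //; exact: measurable_funM.
have mF : measurable_fun setT
    (fun x => (expR (weighted D tau2 g x / c))%:E) by exact/measurable_EFinP.
have rhoD : rho (~` D) = 0%E := samples_in_domain mD density_rho.
have F0 x : setT x -> (0 <= (expR (weighted D tau2 g x / c))%:E)%E.
  by rewrite lee_fin expR_ge0.
rewrite [RHS](ge0_negligible_integral (measurableC mD) measurableT mF F0 rhoD).
rewrite setTD setCK; apply: eq_integral => x; rewrite inE => Dx.
by rewrite Kfun_weighted.
Qed.

(** Otherwise L = 0 almost everywhere and the functional would vanish on V. *)
Lemma integral_representer_gt0 : (0 < \int[mu]_(x in D) (g x)%:E)%E.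
Proof.
rewrite lt_def integral_ge0 ?andbT; last by move=> x Dx; rewrite lee_fin g0.
apply/negP => /eqP int0.
have gabs : (\int[mu]_(x in D) `|(g x)%:E| = 0)%E.
  rewrite -int0; apply: eq_integral => x; rewrite inE => Dx.
  by rewrite gee0_abs// lee_fin g0.
have : ae_eq mu D (EFin \o g) (cst 0%E).
  by apply/ae_eq_integral_abs => //; exact/measurable_EFinP.
move=> g_eq0.
have : (\int[mu]_(x in D) (cabs (L x) ^+ 2)%:E = 0)%E.
  rewrite (ae_eq_integral (cst 0%E))//; first exact: integral0.
    apply/measurable_EFinP; apply: measurable_funX.
    exact: measurable_cabs cmeasurable_riesz_representer.
  apply: filterS g_eq0 => x gx Dx; move: (gx Dx) => /= -[] /eqP.
  rewrite /g mulf_eq0 invr_eq0 (gt_eqF (W0 Dx)) orbF => /eqP ->.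
  by rewrite expr0n.
rewrite /L riesz_representerE (integral_lin_comb_sqr mD orthonormal_phi).
rewrite sqnorm_conj => -[l0].
by have := functional_sqnorm_gt0 linear_Lf Lf_neq0; rewrite l0 ltxx.
Qed.

(** The infimum defining the psi_1 norm need not be known to be attained: the
    mean being positive, the norm is positive, so some admissible c is at most
    twice the norm. *)
Lemma subexponential_scale : (psi1_norm D rho K < +oo)%E ->
  exists a psi c : R,
  [/\ (\int[mu]_(x in D) (g x)%:E = a%:E)%E, psi1_norm D rho K = psi%:E,
      0 < c, c <= 2 * psi &
      (\int[rho]_x (expR (weighted D tau2 g x / c))%:E <= 2%:E)%E].
Proof.
set S := [set c%:E | c in [set c : R | 0 < c /\
  (\int[rho]_(x in D) (expR (K x / c))%:E <= 2%:E)%E]].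
move=> psi_fin; set psi1 := psi1_norm D rho K.
have psi1E : psi1 = ereal_inf S by [].
have int_le c : 0 < c -> (\int[rho]_(x in D) (expR (K x / c))%:E <= 2%:E)%E ->
    (\int[mu]_(x in D) (g x)%:E <= (2 * c)%:E)%E.
  move=> c0; rewrite integral_exp_Kfun -integral_Kfun => Kc.
  exact: integral_le_orlicz Kc.
have [_ [c1 [c10 Kc1] <-] _] := ereal_inf_lt psi_fin.
have afin : (\int[mu]_(x in D) (g x)%:E)%E \is a fin_num.
  rewrite ge0_fin_numE; first exact: le_lt_trans (int_le _ c10 Kc1) (ltry _).
  by apply: integral_ge0 => x Dx; rewrite lee_fin g0.
have aE := fineK afin; set a := fine _ in aE.
have a0 : 0 < a by rewrite -lte_fin aE integral_representer_gt0.
have psi_ge : ((a / 2)%:E <= psi1)%E.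
  rewrite psi1E; apply/ereal_infP => _ [c [c0 Kc] <-].
  rewrite lee_fin ler_pdivrMr// mulrC -lee_fin aE.
  exact: int_le.
have psifin : psi1 \is a fin_num.
  rewrite ge0_fin_numE//; apply: le_trans psi_ge.
  by rewrite lee_fin divr_ge0// ltW.
have psiE := fineK psifin; set psi := fine _ in psiE.
have psi0 : 0 < psi.
  by rewrite -lte_fin psiE (lt_le_trans _ psi_ge)// lte_fin divr_gt0.
have : (ereal_inf S < (2 * psi)%:E)%E.
  by rewrite -psi1E -psiE lte_fin ltr_pMl// ltr1n.
move=> /ereal_inf_lt[_ [c [c0 Kc] <-]]; rewrite lte_fin => c_lt.
exists a, psi, c; split; [exact: esym|exact: esym|exact: c0|exact: ltW|].
by rewrite -integral_exp_Kfun.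
Qed.

(** With s = 40 psi ln (6 / xi) / sqrt M and c <= 2 psi, the exponent of
    [subexponential_tail] is at most 8 - 10 ln (6 / xi) <= - 2 ln (6 / xi),
    because ln (6 / xi) >= 1. The resulting probability is (xi / 6)^2. *)
Lemma average_Kfun_tail dO (Omega : measurableType dO) (P : probability Omega R)
    M (x : 'I_M -> {mfun Omega >-> T}) (a psi c xi : R) :
  iid_samples P rho x -> (0 < M)%N -> 0 < xi -> xi < 1 ->
  (\int[mu]_(x in D) (g x)%:E = a%:E)%E ->
  0 < c -> c <= 2 * psi ->
  (\int[rho]_x (expR (weighted D tau2 g x / c))%:E <= 2%:E)%E ->
  fails_with_prob_le P (xi / 9) (fun w => (forall m, D (x m w)) ->
    M%:R^-1 * \sum_(m < M) K (x m w) <=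
    a + 40 * psi * (ln (6 / xi) / Num.sqrt M%:R)).
Proof.
move=> iid_x M0 xi0 xi1 aE c0 c_le Kc.
set lg := ln (6 / xi).
have M0' : 0 < (M%:R : R) by rewrite ltr0n.
have e6 : expR 1 <= 6 :> R.
  have -> : (1 : R) = 3%:R * 3^-1 by field.
  rewrite expRM_natl; have h : expR (3^-1 : R) <= 13 / 9.
    have := @expR_le_quadratic R 3^-1; rewrite ger0_norm// => /(_ (lexx _)).
    by lra.
  by apply: le_trans (lerXn2r 3 _ _ h) _; rewrite ?nnegrE ?expR_ge0//; lra.
have xi6 : 6 <= 6 / xi by rewrite ler_pdivlMr// ger_pMr// ltW.
have lg1 : 1 <= lg.
  rewrite -[leLHS]expRK /lg ler_ln ?posrE ?expR_gt0//; last exact: lt_le_trans xi6.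
  exact: le_trans e6 xi6.
have expNlg : expR (- lg) = xi / 6.
  by rewrite expRN lnK ?posrE ?divr_gt0// invf_div.
pose s := 40 * psi * (lg / Num.sqrt M%:R).
have r0 : 0 < Num.sqrt (M%:R : R) by rewrite sqrtr_gt0.
have aE' : (\int[rho]_x (weighted D tau2 g x)%:E = a%:E)%E by rewrite integral_Kfun.
have := subexponential_tail iid_x s M0 c0 mK K0 aE' Kc.
have bound : expR (8 - Num.sqrt M%:R * s / (2 * c)) <= xi / 9.
  have -> : Num.sqrt M%:R * s / (2 * c) = 20 * psi * lg / c.
    by rewrite /s; field; rewrite !gt_eqF.
  apply: (@le_trans _ _ (expR (2%:R * (- lg)))).
    rewrite ler_expR.
    have : 10 * lg <= 20 * psi * lg / c.
      rewrite ler_pdivlMr// mulrAC ler_wpM2r//; last lra.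
      by lra.
    by lra.
  rewrite expRM_natl expNlg; have xi2 : xi ^+ 2 <= xi.
    by rewrite expr2 ger_pMr// ltW.
  have -> : (xi / 6) ^+ 2 = xi ^+ 2 / 36 by field.
  by lra.
move=> tail.
have mS : measurable_fun setT (fun w => \sum_(m < M) weighted D tau2 g (x m w)).
  by apply: measurable_sum => m; exact: measurableT_comp.
apply: fails_with_prob_leW bound _ (fails_with_prob_le_lt mS tail) => w Sw wD.
rewrite mulrC ler_pdivrMr// mulrC; apply: le_trans (ltW Sw).
by apply: ler_sum => m _; rewrite Kfun_weighted.
Qed.

End reference_weight.

(** * The angle condition and the Gram matrix *)

Section angle.
Context d (T : measurableType d) (R : realType).
Context (mu : {measure set T -> \bar R}) (D : set T) (N : nat).
Context (phi : 'I_N -> T -> R[i]) (tau2 : T -> R) (rho : probability T R).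
Context (Lf : (T -> R[i]) -> R[i]).
Hypothesis mD : measurable D.
Hypothesis orthonormal_phi : orthonormal_system mu D phi.
Hypothesis linear_Lf : linear_functional_on (lin_span phi) Lf.
Hypothesis Lf_neq0 : exists v, lin_span phi v /\ Lf v != 0.

Let L := riesz_representer phi Lf.
Let dn := dual_norm mu D (lin_span phi) Lf.

Let dn0 : 0 < dn.
Proof.
apply: lt_le_trans (le_dual_norm mD orthonormal_phi linear_Lf Lf_neq0).
by rewrite sqrtr_gt0; exact: functional_sqnorm_gt0 linear_Lf Lf_neq0.
Qed.

(** Clearing the denominators removes the conventions for ratios and shows
    that the event is measurable. Points with k = 0 have cos gamma = 1 and
    drop out as J > 1. *)
Lemma tail_setE (J : R) : 1 < J ->
  [set x | D x /\ ((Num.sqrt J)%:E <= nnratio 1 (cos_gamma mu D phi Lf x))%E] =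
  D `&` [set x | 0 < christoffel phi x]
    `&` [set x | J * cabs (L x) ^+ 2 <= dn ^+ 2 * christoffel phi x].
Proof.
move=> J1; have J0 : 0 < J by exact: lt_trans J1.
have sJ : 1 < Num.sqrt J by rewrite -[ltLHS]sqrtr1 ltr_sqrt.
have E x : ((Num.sqrt J)%:E <= nnratio 1 (cos_gamma mu D phi Lf x))%E <->
    0 < christoffel phi x /\ J * cabs (L x) ^+ 2 <= dn ^+ 2 * christoffel phi x.
  rewrite /cos_gamma; case: ltP => k0; last first.
    rewrite /nnratio oner_eq0 lee_fin divr1 leNgt sJ.
    by split => // -[].
  set b := dn * Num.sqrt (christoffel phi x).
  have b0 : 0 < b by rewrite mulr_gt0// sqrtr_gt0.
  have b2 : b ^+ 2 = dn ^+ 2 * christoffel phi x.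
    by rewrite exprMn sqr_sqrtr// ltW.
  have J2 : J * cabs (L x) ^+ 2 = (Num.sqrt J * cabs (L x)) ^+ 2.
    by rewrite exprMn sqr_sqrtr// ltW.
  have sL0 : 0 <= Num.sqrt J * cabs (L x) by rewrite mulr_ge0 ?cabs_ge0 ?sqrtr_ge0.
  rewrite -b2 J2 ler_pXn2r// ?nnegrE ?sL0 ?(ltW b0)//.
  rewrite -/L -/b /nnratio mulf_eq0 invr_eq0 (gt_eqF b0) orbF.
  have [->|Lx0] := eqVneq (cabs (L x)) 0.
    by rewrite oner_eq0 leey mulr0 (ltW b0).
  have Lx : 0 < cabs (L x) by rewrite lt0r Lx0 cabs_ge0.
  by rewrite lee_fin mul1r invf_div ler_pdivlMr//; split => // -[].
apply/seteqP; split => [x [Dx /E[k0 kL]]|x [[Dx k0] kL]] //.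
by split => //; apply/E.
Qed.

Lemma measurable_tail_set (J : R) :
  measurable (D `&` [set x | 0 < christoffel phi x]
    `&` [set x | J * cabs (L x) ^+ 2 <= dn ^+ 2 * christoffel phi x]).
Proof.
have mk : measurable_fun D (christoffel phi) := measurable_christoffel orthonormal_phi.
have mL : measurable_fun D (fun x => cabs (L x)).
  by apply: measurable_cabs; exact: cmeasurable_riesz_representer orthonormal_phi.
rewrite -setIA setIIr; apply: measurableI.
  exact: (measurable_fun_ltr (measurable_cst (0 : R)) mk mD (Y := [set true])).
have mLk : measurable_fun D
    (fun x => J * cabs (L x) ^+ 2 <= dn ^+ 2 * christoffel phi x).
  apply: measurable_fun_ler; last exact: measurable_funM.
  by apply: measurable_funM => //; exact: measurable_funX.
exact: (mLk mD [set true]).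
Qed.

(** The dual norm dominates |l|, so the condition at the samples can be stated
    with |l|. *)
Lemma samples_angle dO (Omega : measurableType dO) (P : probability Omega R)
    M (x : 'I_M -> {mfun Omega >-> T}) (J p : R) :
  iid_samples P rho x -> 1 < J -> (tail_prob mu D phi rho Lf J <= p%:E)%E ->
  fails_with_prob_le P (M%:R * p) (fun w => (forall m, D (x m w)) ->
    forall m, sqnorm (fun n => Lf (phi n)) * christoffel phi (x m w)
              <= J * cabs (L (x m w)) ^+ 2).
Proof.
move=> iid_x J1; rewrite /tail_prob tail_setE// => pJ.
apply: fails_with_prob_leW (lexx _) _
  (samples_avoid iid_x (measurable_tail_set J) pJ) => w out wD m.
have [k0|k0] := ltP 0 (christoffel phi (x m w)); last first.
  have -> : christoffel phi (x m w) = 0.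
    by apply/eqP; rewrite eq_le k0 christoffel_ge0.
  rewrite mulr0; apply: mulr_ge0; last exact: sqr_ge0.
  exact: ltW (lt_trans ltr01 J1).
have [//|bad] := leP (sqnorm (fun n => Lf (phi n)) * christoffel phi (x m w))
  (J * cabs (L (x m w)) ^+ 2).
exfalso; apply: (out m); split; first by split.
rewrite /=; apply: le_trans (ltW bad) _; rewrite ler_pM2r//.
rewrite -[leLHS](sqr_sqrtr (sqnorm_ge0 _)) lerXn2r ?nnegrE ?sqrtr_ge0 ?(ltW dn0)//.
exact: le_dual_norm.
Qed.

(** The rows of G - 1 are the empirical pairings of the basis functions. Each
    is controlled to accuracy 1 / (100 N) in squared norm, so that the squared
    Frobenius norm is at most 1 / 100. *)
Lemma gram_deviation dO (Omega : measurableType dO) (P : probability Omega R)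
    M (x : 'I_M -> {mfun Omega >-> T}) (Q : R) :
  sampling_density mu D phi tau2 -> has_density mu D rho tau2 ->
  0 <= Q -> {ae rho, forall y, D y -> christoffel phi y <= Q * tau2 y} ->
  iid_samples P rho x -> (0 < M)%N -> (0 < N)%N ->
  fails_with_prob_le P
    (N%:R * (4 * N%:R * expR (- (5 / 24 * (M%:R * (100 * N%:R)^-1) / Q))))
    (fun w => (forall m, D (x m w)) ->
       \sum_(j < N) sqnorm ((gram phi tau2 (fun m => x m w) - 1%:M) ^~ j)
         <= 10^-1 ^+ 2).
Proof.
move=> density_tau2 density_rho Q0 kQ iid_x M0 N0.
have N0' : 0 < (N%:R : R) by rewrite ltr0n.
pose e i (n : 'I_N) : R[i] := (n == i)%:R.
have e1 i : sqnorm (e i) = 1.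
  rewrite /sqnorm (bigD1 i)//= big1 ?addr0; last first.
    by move=> n /negbTE ni; rewrite /e ni cabs0 expr0n.
  by rewrite /e eqxx (cabs_real ler01) expr1n.
have eE i : lin_comb phi (e i) = phi i.
  apply/funext => y; rewrite /lin_comb (bigD1 i)//= big1 ?addr0.
    by rewrite /e eqxx mul1r.
  by move=> n /negbTE ni; rewrite /e ni mul0r.
have al0 : 0 < (100 * N%:R)^-1 :> R by rewrite invr_gt0 mulr_gt0.
have al_le : (100 * N%:R)^-1 <= (20 * N%:R)^-1 :> R.
  by rewrite lef_pV2 ?posrE ?mulr_gt0// ler_pM2r// ler_nat.
have row_dev i := empirical_pairing_deviation mD orthonormal_phi density_tau2
  density_rho Q0 kQ iid_x M0 N0 (c := e i) (al := (100 * N%:R)^-1).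
have {}row_dev i := row_dev i (eq_ind_r (fun t => 0 < t) ltr01 (e1 i)) al0 al_le.
rewrite -[X in X%:R * (4 * _ * _)]card_ord.
apply: fails_with_prob_leW (lexx _) _ (fails_with_prob_le_all row_dev) => w dev wD.
rewrite /sqnorm exchange_big /=.
apply: (@le_trans _ _ (\sum_(i < N) (100 * N%:R)^-1)); last first.
  rewrite sumr_const card_ord -[leLHS]mulr_natl le_eqVlt.
  by apply/orP; left; apply/eqP; field; rewrite gt_eqF.
apply: ler_sum => i _; have := dev i wD; rewrite e1 mulr1; apply: le_trans.
rewrite le_eqVlt; apply/orP; left; apply/eqP; apply: eq_bigr => j _.
rewrite !mxE eE; congr (cabs (_ - _) ^+ 2).
by rewrite /e eq_sym; exact: (esym (conjc_nat R _)).
Qed.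

End angle.

(** * The quadrature estimate *)

Section main.
Context d (T : measurableType d) (R : realType).
Context (mu : {measure set T -> \bar R}) (D : set T) (N : nat).
Context (phi : 'I_N -> T -> R[i]) (tau2 : T -> R) (rho : probability T R).
Context (Lf : (T -> R[i]) -> R[i]).
Hypothesis mD : measurable D.
Hypothesis N_gt0 : (0 < N)%N.
Hypothesis orthonormal_phi : orthonormal_system mu D phi.
Hypothesis density_tau2 : sampling_density mu D phi tau2.
Hypothesis density_rho : has_density mu D rho tau2.
Hypothesis linear_Lf : linear_functional_on (lin_span phi) Lf.
Hypothesis Lf_neq0 : exists v, lin_span phi v /\ Lf v != 0.

(** The product form k <= Q tau2 covers the points where tau2 vanishes. *)
Lemma Qsup_bound : (Qsup phi rho tau2 < +oo)%E -> exists Q : R,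
  [/\ Qsup phi rho tau2 = Q%:E, 0 <= Q &
      {ae rho, forall x, D x -> christoffel phi x <= Q * tau2 x}].
Proof.
move=> Qfin.
have tau0 x : D x -> 0 <= tau2 x by case: density_tau2 => _ + _ _; exact.
have rhoD : rho (~` D) = 0%E := samples_in_domain mD density_rho.
have inD : {ae rho, forall x, D x}.
  exists (~` D); split; first exact: measurableC.
    exact: rhoD.
  by move=> x /=.
have Qge0 : (0 <= Qsup phi rho tau2)%E.
  apply: ess_sup_gee; first by rewrite [ltRHS]probability_setT lte01.
  apply: filterS inD => x Dx; rewrite /nnratio.
  case: ifP => _; first by case: ifP => _; rewrite ?lexx ?leey.
  by rewrite lee_fin divr_ge0 ?christoffel_ge0 ?tau0.
have Qnum : Qsup phi rho tau2 \is a fin_num by rewrite ge0_fin_numE.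
exists (fine (Qsup phi rho tau2)); split; rewrite ?fineK ?fine_ge0//.
apply: filterS (ess_sup_ge rho (fun x => nnratio (christoffel phi x) (tau2 x))).
move=> x; rewrite -/(Qsup phi rho tau2) -[X in (_ <= X)%E](fineK Qnum).
move: (fine _) => Q kQ Dx; move: kQ; rewrite /nnratio.
case: eqVneq => [->|t0].
  by case: eqVneq => [->|_]; rewrite ?mulr0// leye_eq.
by rewrite lee_fin ler_pdivrMr// lt0r t0 tau0.
Qed.

Lemma tail_prob_eventually (e : R) : 0 < e ->
  (fun J : R => (J%:E * tail_prob mu D phi rho Lf J)%E) @ +oo%R --> 0%E ->
  exists J0 : R, forall J, 0 < J -> J0 < J ->
    (tail_prob mu D phi rho Lf J <= (e / J)%:E)%E.
Proof.
move=> e0 cv.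
have small : nbhs (0%E : \bar R) [set y | (y < e%:E)%E].
  by apply: open_nbhs_nbhs; split; [exact: open_ereal_lt_ereal|rewrite /= lte_fin].
have [J0 [_ HJ]] := cv _ small.
exists J0 => J Jpos /HJ /= h.
by rewrite EFinM lee_pdivlMr// muleC ltW.
Qed.

Let exists_nat_gt4 (s t u v : R) : exists M : nat,
  [/\ s < M%:R, t < M%:R, u < M%:R & v < M%:R].
Proof.
have [s0 t0 u0 v0] := And4 (normr_ge0 s) (normr_ge0 t) (normr_ge0 u) (normr_ge0 v).
have [sl tl ul vl] := And4 (ler_norm s) (ler_norm t) (ler_norm u) (ler_norm v).
have sum0 : 0 <= `|s| + `|t| + `|u| + `|v| by lra.
by exists (Num.bound (`|s| + `|t| + `|u| + `|v|)); have := archi_boundP sum0;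
  split; lra.
Qed.

(** The budget of xi is xi / 9 for the angle, xi / 9 for the Gram matrix,
    2 xi / 3 for the functional and xi / 9 for the weight average. The
    squared error allowed for l G is al = (9/10)^2 sigma^2 / J relative to
    |l|^2. It equals k Q Lam / M with k = 6 (9/10)^2, so the exponent in
    [empirical_pairing_deviation] is (5/24) k Lam >= Lam. *)
Lemma ls_quadrature_concentration (W : T -> R) (sigma xi : R) :
  approximation_weight D W ->
  relatively_admissible mu D phi rho tau2 Lf ->
  (psi1_norm D rho (Kfun phi tau2 W Lf) < +oo)%E ->
  0 < sigma -> 0 < xi -> xi < 1 ->
  exists (J : R) (M : nat),
    [/\ 1 <= J,
        ((6 * J / sigma ^+ 2 * ln (6 * N%:R / xi))%:E * Qsup phi rho tau2
           <= (M%:R)%:E)%E,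
        ((M%:R)%:E <=
         (7 * J / sigma ^+ 2 * ln (6 * N%:R / xi))%:E * Qsup phi rho tau2)%E
      & forall (dO : measure_display) (Omega : measurableType dO)
          (P : probability Omega R) (x : 'I_M -> {mfun Omega >-> T}),
          iid_samples P rho x ->
          fails_with_prob_le P xi (fun omega =>
            let pts := fun m => x m omega in
            [/\ well_defined_rule phi tau2 pts,
                exact_on phi tau2 Lf pts (lin_span phi)
              & (cond_number D W (ls_rule phi tau2 Lf pts) <=
                 (1 + sigma)%:E *
                 (\int[mu]_(y in D)
                     (cabs (riesz_representer phi Lf y) / W y)%:E
                  + 40%:E * psi1_norm D rho (Kfun phi tau2 W Lf)
                    * (ln (6 / xi) / Num.sqrt M%:R)%:E))%E])].
Proof.
move=> weight_W [Qfin tail_cvg] psi_fin sg0 xi0 xi1.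
have [Q [QE Q0 kQ]] := Qsup_bound Qfin.
have N0 : 0 < (N%:R : R) by rewrite ltr0n.
have Qpos : 0 < Q.
  exact: lt_le_trans N0 (dim_le_sup mD orthonormal_phi density_tau2 density_rho Q0 kQ).
have [a [psi [c [aE psiE c0 c_le Kc]]]] := subexponential_scale mD orthonormal_phi
  density_tau2 density_rho linear_Lf Lf_neq0 weight_W psi_fin.
have [Lam LamE] : {Lam : R | Lam = ln (6 * N%:R / xi)} by exists (ln (6 * N%:R / xi)).
have arg1 : 1 < 6 * N%:R / xi.
  rewrite ltr_pdivlMr// mul1r (lt_le_trans xi1)//.
  by rewrite -natrM ler1n muln_gt0 N_gt0.
have Lam0 : 0 < Lam by rewrite LamE ln_gt0.
have expNLam : expR (- Lam) = xi / (6 * N%:R).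
  by rewrite LamE expRN lnK ?posrE ?invf_div// (lt_trans ltr01 arg1).
pose b := sigma ^+ 2 / (6 * Q * Lam).
have b0 : 0 < b by rewrite divr_gt0 ?exprn_gt0 ?mulr_gt0.
have [J0 tailJ] := tail_prob_eventually (mulr_gt0 b0 (divr_gt0 xi0 (ltr0n R 9))) tail_cvg.
(* Existentials keep the constants abstract in the arithmetic steps. Here k is
   al M / (Q Lam), and q is the rate, per sample, of the Gram matrix bound. *)
have [k kE] : {k : R | k = 6 * (9 / 10) ^+ 2} by exists (6 * (9 / 10) ^+ 2).
have k0 : 0 < k by rewrite kE; lra.
have k1 : 1 <= 5 / 24 * k by rewrite kE; lra.
have [q qE] : {q : R | q = 5 / 24 / (100 * N%:R) / Q}.
  by exists (5 / 24 / (100 * N%:R) / Q).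
have q0 : 0 < q.
  have h : 0 < (5 / 24 / 100 : R) by lra.
  have -> : q = (5 / 24 / 100) / (N%:R * Q) by rewrite qE; field; rewrite !gt_eqF.
  by apply: divr_gt0 => //; exact: mulr_gt0.
have xi9 : 0 < xi / 9 by lra.
have [M [M1 M2 M3 M4]] := exists_nat_gt4 (2 / b) (`|J0| / b)
  (k * Q * Lam * (20 * N%:R)) (N%:R * (4 * N%:R) / (xi / 9 * q)).
have M0 : 0 < (M%:R : R) by apply: lt_trans M1; rewrite divr_gt0.
have Mgt0 : (0 < M)%N by rewrite -(ltr0n R).
have [J JE] : {J : R | J = M%:R * b} by exists (M%:R * b).
have J2 : 2 < J by rewrite JE -ltr_pdivrMr.
have J0lt : J0 < J.
  by rewrite JE (le_lt_trans (ler_norm _))// -ltr_pdivrMr.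
have Jpos : 0 < J by apply: lt_trans J2.
have J1 : 1 < J by apply: lt_trans J2; rewrite ltr1n.
have ME : 6 * J / sigma ^+ 2 * Lam * Q = M%:R.
  by rewrite JE /b; field; rewrite !gt_eqF.
exists J, M; rewrite QE -LamE; split; first exact: ltW.
- by rewrite -EFinM lee_fin ME.
- rewrite -EFinM lee_fin -[leLHS]ME.
  have -> : 7 * J / sigma ^+ 2 * Lam * Q = 6 * J / sigma ^+ 2 * Lam * Q * (7 / 6).
    by field; rewrite gt_eqF.
  by rewrite ME ler_pMr//; lra.
move=> dO Omega P x iid_x.
have in_domain : fails_with_prob_le P 0 (fun w => forall m, D (x m w)).
  have rhoD : (rho (~` D) <= 0%:E)%E by rewrite (samples_in_domain mD density_rho).
  apply: fails_with_prob_leW (samples_avoid iid_x (measurableC mD) rhoD).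
    by rewrite mulr0.
  by move=> w out m; apply: contrapT; exact: out.
have angle := samples_angle mD orthonormal_phi linear_Lf Lf_neq0 iid_x J1
  (tailJ J Jpos J0lt).
have gram_dev := gram_deviation mD orthonormal_phi density_tau2 density_rho
  Q0 kQ iid_x Mgt0 N_gt0.
pose ellc n : R[i] := ((Lf (phi n))^*)%C.
have ellc0 : 0 < sqnorm ellc.
  by rewrite sqnorm_conj; exact: functional_sqnorm_gt0 linear_Lf Lf_neq0.
have [al alE] : {al : R | al = k * Q * Lam / M%:R} by exists (k * Q * Lam / M%:R).
have al0 : 0 < al.
  by rewrite alE; apply: divr_gt0 => //; apply: mulr_gt0 => //; exact: mulr_gt0.
have N20 : 0 < 20 * N%:R :> R by apply: mulr_gt0.
have al_le : al <= (20 * N%:R)^-1.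
  by rewrite alE -[leRHS]mul1r ler_pdivlMr// mulrAC ler_pdivrMr// mul1r ltW.
have ell_dev := empirical_pairing_deviation mD orthonormal_phi density_tau2
  density_rho Q0 kQ iid_x Mgt0 N_gt0 ellc0 al0 al_le.
have K_dev := average_Kfun_tail mD orthonormal_phi density_tau2 density_rho
  weight_W iid_x Mgt0 xi0 xi1 aE c0 c_le Kc.
apply: fails_with_prob_leW (fails_with_prob_le_and in_domain
  (fails_with_prob_le_and angle (fails_with_prob_le_and gram_dev
  (fails_with_prob_le_and ell_dev K_dev)))).
  have p1 : M%:R * (b * (xi / 9) / J) = xi / 9.
    by rewrite JE; field; rewrite !gt_eqF.
  have p2 : N%:R * (4 * N%:R * expR (- (5 / 24 * (M%:R / (100 * N%:R)) / Q)))
      <= xi / 9.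
    have [y yE] : {y : R | y = M%:R * q} by exists (M%:R * q).
    have -> : 5 / 24 * (M%:R / (100 * N%:R)) / Q = y.
      by rewrite yE qE; field; rewrite !gt_eqF.
    have y0 : 0 < y by rewrite yE mulr_gt0.
    have ey : expR (- y) <= y^-1.
      rewrite expRN lef_pV2 ?posrE ?expR_gt0//.
      by apply: le_trans (expR_ge1Dx y); rewrite lerDr.
    have NN0 : 0 <= N%:R * (4 * N%:R) :> R by apply: mulr_ge0.
    rewrite mulrA; apply: (@le_trans _ _ (N%:R * (4 * N%:R) * y^-1)).
      by rewrite ler_wpM2l.
    rewrite ler_pdivrMr//.
    have -> : xi / 9 * y = M%:R * (xi / 9 * q) by rewrite yE; ring.
    by rewrite -ler_pdivrMr ?(ltW M4)//; exact: mulr_gt0.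
  have p3 : 4 * N%:R * expR (- (5 / 24 * (M%:R * al) / Q)) <= 2 / 3 * xi.
    have N4 : 0 < 4 * N%:R :> R by apply: mulr_gt0.
    apply: (@le_trans _ _ (4 * N%:R * expR (- Lam))).
      rewrite ler_pM2l// ler_expR lerN2 alE.
      have -> : 5 / 24 * (M%:R * (k * Q * Lam / M%:R)) / Q = 5 / 24 * k * Lam.
        by field; rewrite !gt_eqF.
      by rewrite ler_peMl// ltW.
    rewrite expNLam le_eqVlt; apply/orP; left; apply/eqP; field.
    by rewrite gt_eqF.
  by rewrite p1; lra.
move=> w [wD [wangle [wgram [wdev wK]]]] pts.
have ellE : sqnorm ((\row_(n < N) Lf (phi n)) ord0) = sqnorm (fun n => Lf (phi n)).
  by apply: eq_bigr => n _; rewrite mxE.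
have G1 := wgram wD.
have a0 : 0 <= al by exact: ltW.
have ellG : sqnorm (((\row_(n < N) Lf (phi n)) *m gram phi tau2 pts
    - \row_(n < N) Lf (phi n)) ord0)
    <= al * sqnorm ((\row_(n < N) Lf (phi n)) ord0).
  have lE n : (\row_(i < N) Lf (phi i)) ord0 n = ((ellc n)^*)%C.
    by rewrite mxE /ellc conjcK.
  rewrite (sqnorm_gramB phi tau2 pts lE).
  rewrite ellE -(sqnorm_conj (fun n => Lf (phi n))).
  exact: wdev wD.
have aJ : al * J <= (9 / 10) ^+ 2 * sigma ^+ 2.
  rewrite alE JE /b kE le_eqVlt; apply/orP; left; apply/eqP; field.
  by rewrite !gt_eqF.
have tau0 y : D y -> 0 <= tau2 y by case: density_tau2 => _ + _ _; exact.
have W0 y : D y -> 0 < W y by case: weight_W => _; exact.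
have wangle' m : sqnorm ((\row_(n < N) Lf (phi n)) ord0) * christoffel phi (pts m)
    <= J * cabs (riesz_representer phi Lf (pts m)) ^+ 2.
  by rewrite ellE; exact: wangle.
split.
- exact: gram_unit G1.
- exact: ls_rule_exact linear_Lf G1.
apply: le_trans (cond_number_ls_rule_le Mgt0 G1 ellG a0 (ltW sg0) aJ wD tau0
  wangle' W0) _.
rewrite aE psiE; set rhs := (X in (_ <= X)%E).
have -> : rhs = ((1 + sigma) *
    (a + 40 * psi * (ln (6 / xi) / Num.sqrt M%:R)))%:E by [].
rewrite lee_fin; apply: ler_wpM2l; last exact: wK wD.
by rewrite addr_ge0// ltW.
Qed.

End main.

(* Sigma is any sigma-algebra containing the open sets (Borel sets, or the
   domain of a completion of mu); g_sigma_algebraType Sigma is X equipped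
   with it. The probability statement is expressed by a measurable event of
   probability at least 1 - xi on which the conclusions hold. *)
Theorem theorem2p6 (R : realType) :
  exists C : R, 0 < C /\
  forall (X : completeNormedModType R) (Sigma : set (set X))
    (sigma_algebra_Sigma : sigma_algebra [set: X] Sigma)
    (open_Sigma : forall U : set X, open U -> Sigma U)
    (mu : {measure set (g_sigma_algebraType Sigma) -> \bar R})
    (D : set (g_sigma_algebraType Sigma)) (support_D : closed_support (X := X) mu D)
    (N : nat) (N_gt0 : (0 < N)%N)
    (phi : 'I_N -> g_sigma_algebraType Sigma -> R[i])
    (orthonormal_phi : orthonormal_system mu D phi)
    (tau2 : g_sigma_algebraType Sigma -> R)
    (density_tau2 : sampling_density mu D phi tau2)
    (rho : probability (g_sigma_algebraType Sigma) R)
    (density_rho : has_density mu D rho tau2)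
    (Lf : (g_sigma_algebraType Sigma -> R[i]) -> R[i])
    (linear_Lf : linear_functional_on (lin_span phi) Lf)
    (Lf_neq0 : exists v, lin_span phi v /\ Lf v != 0)
    (W : g_sigma_algebraType Sigma -> R)
    (weight_W : approximation_weight D W)
    (admissible : relatively_admissible mu D phi rho tau2 Lf)
    (concentration : (psi1_norm D rho (Kfun phi tau2 W Lf) < +oo)%E)
    (sigma xi : R),
    0 < sigma -> 0 < xi -> xi < 1 ->
    exists (J : R) (M : nat),
      [/\ 1 <= J,
          ((6 * J / sigma ^+ 2 * ln (6 * N%:R / xi))%:E * Qsup phi rho tau2
             <= (M%:R)%:E)%E,
          ((M%:R)%:E <=
           (7 * J / sigma ^+ 2 * ln (6 * N%:R / xi))%:E * Qsup phi rho tau2)%E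
        & forall (dO : measure_display) (Omega : measurableType dO)
            (P : probability Omega R)
            (x : 'I_M -> {mfun Omega >-> g_sigma_algebraType Sigma}),
            iid_samples P rho x ->
            exists E : set Omega,
              [/\ measurable E, ((1 - xi)%:E <= P E)%E
                & forall omega, E omega ->
                    let pts := fun m => x m omega in
                    [/\ well_defined_rule phi tau2 pts,
                        exact_on phi tau2 Lf pts (lin_span phi)
                      & (cond_number D W (ls_rule phi tau2 Lf pts) <=
                         (1 + sigma)%:E *
                         (\int[mu]_(y in D)
                             (cabs (riesz_representer phi Lf y) / W y)%:E
                          + C%:E * psi1_norm D rho (Kfun phi tau2 W Lf)
                            * (ln (6 / xi) / Num.sqrt M%:R)%:E))%E]]].
Proof.
exists 40; split => // X Sigma sigma_algebra_Sigma open_Sigma mu D support_D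
  N N_gt0 phi orthonormal_phi tau2 density_tau2 rho density_rho Lf linear_Lf
  Lf_neq0 W weight_W admissible concentration sigma xi sigma0 xi0 xi1.
have mD : measurable D.
  have [closedD _ _] := support_D.
  rewrite -[D]setCK; apply: measurableC; apply: sub_sigma_algebra.
  by apply: open_Sigma; exact: closed_openC.
have [J [M [J1 MJ JM good]]] := ls_quadrature_concentration mD N_gt0
  orthonormal_phi density_tau2 density_rho linear_Lf Lf_neq0 weight_W admissible
  concentration sigma0 xi0 xi1.
exists J, M; split => // dO Omega P x iid_x.
have [B [mB PB goodB]] := good _ _ P x iid_x.
exists (~` B); split; [exact: measurableC| |exact: goodB].
by rewrite probability_setC// EFinB leeB.
Qed.
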